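(* Let $\lambda,\mu$ be partitions with lengths $r_1,r_2$ and associated sequences $(n_i)_{i=1}^{r_1}$, $(m_j)_{j=1}^{r_2}$, set $r=r_1+r_2$, and let $\alpha,\beta\in\mathbb{R}$ be such that $$\alpha+\beta+n_i\notin\{-1,\dots,-n_i\}\ (1\le i\le r_1),\qquad \alpha-\beta+m_j\notin\{-1,\dots,-m_j\}\ (1\le j\le r_2),$$ $$\beta\ne m_j-n_i\ (1\le i\le r_1,\ 1\le j\le r_2).$$ Assume that $\alpha+r>-1$ and $\beta+r>-1$. For $n\in\mathbb{N}_{\lambda,\mu}$ let $1>x^{(\alpha,\beta)}_{1,n}\ge\dots\ge x^{(\alpha,\beta)}_{N(n),n}>-1$ denote the zeros of $P^{(\alpha,\beta)}_{\lambda,\mu,n}$ in $(-1,1)$, listed with multiplicity. Then, for every bounded continuous function $f$ on $(-1,1)$, $$\lim_{n\to\infty,\ n\in\mathbb{N}_{\lambda,\mu}}\frac{1}{N(n)}\sum_{j=1}^{N(n)}f\big(x^{(\alpha,\beta)}_{j,n}\big)=\frac1\pi\int_{-1}^1\frac{f(x)}{\sqrt{1-x^2}}\,dx.$$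
   Context: Jacobi polynomials: for $\alpha,\beta\in\mathbb{R}$ and an integer $n\ge 0$, $P_n^{(\alpha,\beta)}(x)=2^{-n}\sum_{j=0}^n\binom{n+\alpha}{j}\binom{n+\beta}{n-j}(x-1)^{n-j}(x+1)^j$ (generalized binomial coefficients). A set $\{-1,-2,\dots,-k\}$ is empty when $k=0$. Wronskian: $\mathrm{Wr}[g_1,\dots,g_k]=\det\big(\tfrac{d^{i-1}}{dx^{i-1}}g_j\big)_{1\le i,j\le k}$. Partitions: a partition $\lambda$ is a weakly decreasing finite (possibly empty) sequence of positive integers $\lambda_1\ge\dots\ge\lambda_{r_1}$; $r_1$ is its length, $|\lambda|=\sum_i\lambda_i$, and its associated strictly decreasing sequence is $n_i=\lambda_i+r_1-i$, $1\le i\le r_1$. Likewise $\mu$ has length $r_2$ and associated sequence $m_j=\mu_j+r_2-j$, $1\le j\le r_2$. Degree sequence: $\mathbb{N}_{\lambda,\mu}=\{n\in\mathbb{Z}_{\ge0}: n\ge|\lambda|+|\mu|-r_1\text{ and }n-|\lambda|-|\mu|\ne\lambda_j-j\text{ for }j=1,\dots,r_1\}$. Exceptional Jacobi polynomials: put $f_j(x)=P^{(\alpha,\beta)}_{n_j}(x)$ for $1\le j\le r_1$ and $f_{r_1+j}(x)=(1+x)^{-\beta}P^{(\alpha,-\beta)}_{m_j}(x)$ for $1\le j\le r_2$. For $n\in\mathbb{N}_{\lambda,\mu}$ and $s=n-|\lambda|-|\mu|+r_1$, $$P^{(\alpha,\beta)}_{\lambda,\mu,n}(x)=(1+x)^{(\beta+r_1+1)r_2}\,\mathrm{Wr}[f_1,\dots,f_r,P_s^{(\alpha,\beta)}],$$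 which is a polynomial in $x$ (computed on $x>-1$ and extended to $\mathbb{C}$). $N(n)$ denotes the number of its zeros in $(-1,1)$, counted with multiplicity. *)

(* Defs.v *)
From HB Require Import structures.
From mathcomp Require Import all_boot all_order all_algebra.
From mathcomp Require Import all_classical all_reals all_analysis.
From mathcomp Require polyrcf.

Set Implicit Arguments.
Unset Strict Implicit.
Unset Printing Implicit Defensive.

Import Order.TTheory GRing.Theory Num.Theory.
Import numFieldNormedType.Exports.

Local Open Scope classical_set_scope.
Local Open Scope ring_scope.

Definition is_partition (la : seq nat) : bool :=
  sorted geq la && all (leq 1) la.

(* Zero-based: for i < size la this is n_(i+1) = la_(i+1) + size la - (i+1),
   and the truncated subtraction is exact. *)
Definition assoc_seq (la : seq nat) (i : nat) : nat :=
  (nth 0 la i + size la - i.+1)%N.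

(* Here la_j - j is computed in int, with j = i + 1. *)
Definition degree_seq (la mu : seq nat) : set nat :=
  [set n : nat |
    (sumn la)%:Z + (sumn mu)%:Z - (size la)%:Z <= n%:Z /\
    forall i : nat, (i < size la)%N ->
      n%:Z - (sumn la)%:Z - (sumn mu)%:Z <> (nth 0%N la i)%:Z - (i.+1)%:Z].

Section ExceptionalJacobi.
Variable R : realType.
Implicit Types (al be x : R) (la mu : seq nat) (n : nat).

Definition gbinom (a : R) (k : nat) : R :=
  (\prod_(i < k) (a - i%:R)) / (k`!)%:R.

Definition jacobi al be n : {poly R} :=
  2%:R ^- n *:
  \sum_(j < n.+1) (gbinom (n%:R + al) j * gbinom (n%:R + be) (n - j)) *:
    (('X - 1) ^+ (n - j) * ('X + 1) ^+ j).

Definition wronskian (gs : seq (R -> R)) (x : R) : R :=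
  \det (\matrix_(i < size gs, j < size gs)
          derive1n i (nth (cst 0) gs j) x).

(* The seed functions f_1, ..., f_r; the power of 1 + x is only meaningful
   for x > -1. *)
Definition seed_functions al be la mu : seq (R -> R) :=
  [seq (fun x => (jacobi al be (assoc_seq la i)).[x]) | i <- iota 0 (size la)] ++
  [seq (fun x => (1 + x) `^ (- be) * (jacobi al (- be) (assoc_seq mu j)).[x])
     | j <- iota 0 (size mu)].

(* For n in degree_seq la mu the truncated subtraction defining s is exact. *)
Definition exc_jacobi_fun al be la mu n (x : R) : R :=
  let s := (n + size la - (sumn la + sumn mu))%N in
  (1 + x) `^ ((be + (size la)%:R + 1) * (size mu)%:R) *
  wronskian (rcons (seed_functions al be la mu)
                   (fun y => (jacobi al be s).[y])) x.

(* The polynomial extending exc_jacobi_fun from x > -1 (unique, as it is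
   prescribed on an infinite set); the default 0 would only be taken if there
   were no such polynomial. *)
Definition exc_jacobi al be la mu n : {poly R} :=
  xget 0 [set p : {poly R} |
    forall x : R, -1 < x -> p.[x] = exc_jacobi_fun al be la mu n x].

(* polyrcf.roots p (-1) 1 lists the distinct roots of p in the open interval,
   increasingly (it is empty when p = 0); each is repeated mup times. *)
Definition inner_zeros (p : {poly R}) : seq R :=
  rev (flatten [seq nseq (mup x p) x | x <- polyrcf.roots p (-1) 1]).

Definition exc_jacobi_zeros al be la mu n : seq R :=
  inner_zeros (exc_jacobi al be la mu n).

Definition num_zeros al be la mu n : nat :=
  size (exc_jacobi_zeros al be la mu n).

End ExceptionalJacobi.

(* Main.v *)
(** Pólya's form of Rolle's theorem: on an interval where the Wronskians of
    [f_1, ..., f_k], [k <= r], do not vanish, passing from [g] to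
    [Wr[f_1, ..., f_r, g]] loses at most [r] zeros, because
    [(Wr[F, g] / Wr[F, h])' = Wr[F] Wr[F, h, g] / Wr[F, h]^2].
    In the variable [t = 1 + x] every entry is a power of [t] times a polynomial,
    so these Wronskians have finitely many zeros in [(-1, 1)] (their leading
    coefficients are Vandermonde-like determinants in the distinct numbers [n_i],
    [m_j - beta], [s]), and the exceptional polynomial has in each subinterval the
    zeros of [P_s] up to a number independent of [s].  Sturm comparison for the
    Jacobi equation gives at least [n ((b - a) / pi - e)] zeros of [P_n] in
    [(cos b, cos a)]; since the degree exceeds [n] by a bounded amount only, these
    lower bounds force the arcsine distribution: they give a lower bound for the
    means of [M + f] and of [M - f]. *)

Require Import Defs.
From HB Require Import structures.
From mathcomp Require Import all_boot all_order all_algebra.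
From mathcomp Require Import all_classical all_reals all_analysis.
From mathcomp Require Import perm measurable_realfun.
From mathcomp Require polyrcf.
From mathcomp Require Import ring lra zify.

Import Order.TTheory GRing.Theory Num.Theory.
Import numFieldNormedType.Exports.

Local Open Scope classical_set_scope.
Local Open Scope ring_scope.

Set Implicit Arguments.
Unset Strict Implicit.
Unset Printing Implicit Defensive.

(** * Wronskians as polynomial determinants *)

(** The loss of zeros has to be bounded uniformly in [s]. In the Rolle chain [P_s] is therefore
    always the last column, so that non-vanishing is asked only of Wronskians of the first [k]
    seeds. Their zeros form one finite set free of [s], and cutting an interval at these points
    costs a bounded number of zeros. The non-integral power of [t] is split off before any algebra:
    a function [t^g q(t)] is kept as a pair, and the operator [t d/dt] leaves [g] unchanged. All
    determinants are then polynomial; the powers left out come back only as a difference of two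
    exponents in the Rolle step. The two counts differ in nature: the lower one sees distinct zeros,
    the upper one is the degree and sees multiplicities. They agree to leading order, so repeated
    zeros do not disturb the limit. *)

Lemma det_sum_col (A : comNzRingType) n D (F : 'I_n -> 'I_n -> 'I_D -> A) :
  \det (\matrix_(i, j) \sum_k F i j k) =
  \sum_(f : {ffun 'I_n -> 'I_D}) \det (\matrix_(i, j) F i j (f j)).
Proof.
rewrite -det_tr; under eq_bigr => f _ do rewrite -det_tr.
rewrite exchange_big /=; apply: eq_bigr => s _; rewrite -mulr_sumr; congr (_ * _).
under eq_bigr => i _ do rewrite !mxE.
rewrite bigA_distr_bigA /=; apply: eq_bigr => f _.
by apply: eq_bigr => i _; rewrite !mxE.
Qed.

Lemma det_scale_col_row (A : comNzRingType) n (M : 'M[A]_n) (a b : 'I_n -> A) :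
  \det (\matrix_(i, j) (a i * b j * M i j)) =
  (\prod_i a i) * (\prod_j b j) * \det M.
Proof.
have -> : \matrix_(i, j) (a i * b j * M i j) =
    diag_mx (\row_i a i) *m M *m diag_mx (\row_j b j).
  by apply/matrixP => i j; rewrite mul_mx_diag mul_diag_mx !mxE; ring.
rewrite !det_mulmx !det_diag mulrAC.
by congr (_ * _ * _); apply: eq_bigr => i _; rewrite mxE.
Qed.

Lemma det_eq_col (A : comNzRingType) n (M : 'M[A]_n) j1 j2 :
  j1 != j2 -> (forall i, M i j1 = M i j2) -> \det M = 0.
Proof.
by move=> ne eqM; rewrite -det_tr; apply: (determinant_alternate ne) => i; rewrite !mxE.
Qed.

(** The extreme case is [0, ..., k-1]. The largest entry [m] satisfies [size s <= m.+1], all entries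
    lying in [0, ..., m]; it is removed and the rest is treated by induction. *)
Lemma sum_uniq_nat_ge (s : seq nat) : uniq s -> ('C(size s, 2) <= sumn s)%N.
Proof.
elim: {s}_.+1 {-2}s (ltnSn (size s)) => // n IH s; rewrite ltnS => sn us.
case: s us sn => // x s us sn.
set t := x :: s in us sn *.
pose m := \max_(i <- t) i.
have mt : m \in t.
  rewrite /m /t; elim: (s) (x) => [|y s' IHs] z; first by rewrite big_seq1 mem_head.
  rewrite big_cons inE; case: (leqP z (\max_(j <- y :: s') j)) => h.
    by rewrite IHs orbT.
  by rewrite eqxx.
have mle i : i \in t -> (i <= m)%N by move=> it; rewrite /m (leq_bigmax_seq (F:=id)).
have szm : (size t <= m.+1)%N.
  rewrite -(size_iota 0 m.+1); apply: uniq_leq_size => // i /mle im.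
  by rewrite mem_iota /= add0n ltnS.
have pe := perm_to_rem mt.
have -> : sumn t = (m + sumn (rem m t))%N by rewrite -[(m + _)%N]/(sumn (m :: rem m t)); apply: perm_sumn.
have st : size t = (size (rem m t)).+1 by rewrite (perm_size pe).
rewrite st binS bin1 addnC; apply: leq_add; first by rewrite st ltnS in szm.
apply: IH; last exact: rem_uniq.
by rewrite -ltnS -st ltnS.
Qed.

Section FallingFactorials.
Variable R : fieldType.
Implicit Types (a g : R) (c : R * {poly R}).

Definition ffall a i : R := \prod_(l < i) (a - l%:R).

Lemma ffallS a i : ffall a i.+1 = ffall a i * (a - i%:R).
Proof. by rewrite /ffall big_ord_recr. Qed.

(** Falling factorials are monic of every degree, as monomials are in the Vandermonde matrix. A
    vector killing the rows is a polynomial of degree below [n] with [n] distinct roots. *)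
Lemma det_ffall_neq0 n (x : 'I_n -> R) : injective x ->
  \det (\matrix_(i < n, j < n) ffall (x j) i) != 0.
Proof.
move=> xinj; apply/det0P => -[v v0 vM].
pose ff i : {poly R} := \prod_(l < i) ('X - l%:R%:P).
have sff i : size (ff i) = i.+1.
  by rewrite /ff -big_enum /= size_prod_XsubC size_enum_ord.
have mff i : lead_coef (ff i) = 1.
  by apply/eqP; apply: monic_prod_XsubC.
pose P : {poly R} := \sum_(i < n) v 0 i *: ff i.
have Px j : P.[x j] = 0.
  move/rowP/(_ j): vM; rewrite !mxE => <-; rewrite horner_sum.
  apply: eq_bigr => i _; rewrite !mxE hornerZ; congr (_ * _).
  rewrite /ff horner_prod; apply: eq_bigr => l _.
  by rewrite hornerXsubC.
have sP : (size P <= n)%N.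
  apply: (leq_trans (size_sum _ _ _)); apply/bigmax_leqP => i _.
  by rewrite (leq_trans (size_scale_leq _ _)) // sff.
have P0 : P = 0.
  apply: (@roots_geq_poly_eq0 _ P [seq x i | i <- enum 'I_n]).
  - by apply/allP => _ /mapP[i _ ->]; apply/rootP; exact: Px.
  - by rewrite map_inj_uniq ?enum_uniq.
  - by rewrite size_map size_enum_ord.
case/negP: v0; apply/eqP/rowP => i; rewrite [RHS]mxE.
(* Descending induction on [i]: once the higher coordinates vanish, the coefficient of degree [i] in
   [P] is [v 0 i]. *)
have [k] := ubnP (n - i); elim: k i => // k IH i ki.
have : P`_i = 0 by rewrite P0 coef0.
rewrite coef_sum (bigD1 i) //= big1 => [|j ji].
  rewrite addr0 coefZ; move: (mff i); rewrite lead_coefE sff /= => ->.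
  by rewrite mulr1.
rewrite coefZ; case: (ltngtP i j) => ij.
- by rewrite IH ?mul0r //; have := ltn_ord i; lia.
- by rewrite nth_default ?mulr0 // sff.
- by case/eqP: ji; apply/val_inj.
Qed.

(* The pair [(g, q)] encodes the function [t^g q(t)]; its [i]-th derivative is
   [t^(g-i)] times [tderiv (g, q) i]. *)
Definition tderiv c i : {poly R} :=
  \poly_(k < size c.2) (ffall (c.1 + k%:R) i * c.2`_k).

Lemma coef_tderiv c i k : (tderiv c i)`_k = ffall (c.1 + k%:R) i * c.2`_k.
Proof.
rewrite coef_poly; case: ltnP => // h.
by rewrite nth_default // mulr0.
Qed.

Lemma tderiv0 c : tderiv c 0 = c.2.
Proof. by apply/polyP => k; rewrite coef_tderiv /ffall big_ord0 mul1r. Qed.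

Lemma tderivS c i :
  tderiv c i.+1 = 'X * (tderiv c i)^`() + (c.1 - i%:R) *: tderiv c i.
Proof.
apply/polyP => k; rewrite coefD coefXM coefZ coef_deriv !coef_tderiv ffallS.
case: k => [|k] /=; first by rewrite add0r addr0; ring.
by rewrite -mulr_natr; ring.
Qed.

(* By the remark above, the Wronskian of the functions encoded by the [c j] up to
   powers of [t]. *)
Definition wronp (c : nat -> R * {poly R}) n : {poly R} :=
  \det (\matrix_(i < n, j < n) tderiv (c j) i).

(** The choice function [f] picks one monomial [t^(f j)] from each column; what remains is a
    Vandermonde-like determinant in the exponents [g_j + f j]. Degree, order at [t = 0] and leading
    coefficient are all read off this sum. *)
Lemma wronp_expand (c : nat -> R * {poly R}) n D :
  (forall j, (j < n)%N -> (size (c j).2 <= D)%N) ->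
  wronp c n = \sum_(f : {ffun 'I_n -> 'I_D})
    ((\prod_(j < n) (c j).2`_(f j)) *
     \det (\matrix_(i < n, j < n) ffall ((c j).1 + (f j)%:R) i))
      *: 'X^(\sum_(j < n) f j).
Proof.
move=> cD; rewrite /wronp.
have -> : (\matrix_(i < n, j < n) tderiv (c j) i) =
   \matrix_(i, j) \sum_(k < D) (ffall ((c j).1 + k%:R) i * (c j).2`_k) *: 'X^k.
  apply/matrixP => i j; rewrite !mxE -(poly_def D (fun k => ffall ((c j).1 + k%:R) i * (c j).2`_k)); apply/polyP => k.
  rewrite coef_tderiv coef_poly; case: ltnP => // Dk.
  by rewrite nth_default ?mulr0 // (leq_trans (cD j _)).
rewrite det_sum_col; apply: eq_bigr => f _.
have -> : (\matrix_(i, j) ((ffall ((c j).1 + (f j)%:R) i * (c j).2`_(f j)) *: 'X^(f j))) =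
  \matrix_(i, j) (1 * (((c j).2`_(f j))%:P * 'X^(f j)) *
    (map_mx polyC (\matrix_(i < n, j < n) ffall ((c j).1 + (f j)%:R) i)) i j).
  by apply/matrixP => i j; rewrite !mxE -mul_polyC polyCM; ring.
rewrite (det_scale_col_row _ (fun=> 1)) big1_eq mul1r det_map_mx big_split /=.
by rewrite -mul_polyC polyCM rmorph_prod /= prodrXr; ring.
Qed.

End FallingFactorials.

Lemma sum_inj_nat_ge n (A : {set 'I_n}) (f : 'I_n -> nat) :
  {in A &, injective f} -> ('C(#|A|, 2) <= \sum_(j in A) f j)%N.
Proof.
move=> finj; rewrite -big_enum /= -(big_map f predT id) -sumnE cardE -(size_map f).
apply: sum_uniq_nat_ge; rewrite map_inj_in_uniq ?enum_uniq // => i j.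
by rewrite !mem_enum; exact: finj.
Qed.

Section WronskianPolynomial.
Variable R : fieldType.
Implicit Types (c : nat -> R * {poly R}).

Lemma size_wronp c n :
  (size (wronp c n) <= (\sum_(j < n) (size (c j).2).-1).+1)%N.
Proof.
pose D := \max_(j < n) size (c j).2.
have cD j : (j < n)%N -> (size (c j).2 <= D)%N.
  by move=> jn; exact: (@leq_bigmax _ (fun j : 'I_n => size (c j).2) (Ordinal jn)).
rewrite (wronp_expand cD); apply: (leq_trans (size_sum _ _ _)).
apply/bigmax_leqP => f _.
have [/forallP fs|] := boolP [forall j : 'I_n, (f j < size (c j).2)%N].
  rewrite (leq_trans (size_scale_leq _ _)) // size_polyXn ltnS.
  by apply: leq_sum => j _; rewrite -ltnS (leq_trans (fs j)) // leqSpred.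
rewrite negb_forall => /existsP[j]; rewrite -leqNgt => h.
by rewrite (bigD1 j) //= nth_default // !mul0r scale0r size_poly0.
Qed.

(** Two columns with equal [g] that pick the same power of [t] give equal columns in the
    determinant. A surviving [f] is thus injective on [A] and on its complement, which bounds the
    exponent of [t] from below. *)
Lemma dvdp_wronp c n (A : {set 'I_n}) (g1 g2 : R) :
  (forall j : 'I_n, (c j).1 = if j \in A then g1 else g2) ->
  'X^('C(#|A|, 2) + 'C(#|~: A|, 2)) %| wronp c n.
Proof.
move=> cA; pose D := \max_(j < n) size (c j).2.
have cD j : (j < n)%N -> (size (c j).2 <= D)%N.
  by move=> jn; exact: (@leq_bigmax _ (fun j : 'I_n => size (c j).2) (Ordinal jn)).
rewrite (wronp_expand cD).
elim/big_ind: _ => [|p q|f _]; [exact: dvdp0 | exact: dvdp_add |].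
have H (B : {set 'I_n}) : (forall i j, i \in B -> j \in B -> (c i).1 = (c j).1) ->
    ~~ ('C(#|B|, 2) <= \sum_(j in B) f j)%N ->
    \det (\matrix_(i < n, j < n) ffall ((c j).1 + (f j)%:R) i) = 0.
  move=> cB nB; have [inj|] := boolP [forall i in B, [forall j in B, (f i == f j) ==> (i == j)]].
    case/negP: nB; apply: sum_inj_nat_ge => i j iB jB fij; apply/eqP.
    move: inj => /forall_inP/(_ i iB)/forall_inP/(_ j jB)/implyP; apply.
    by apply/eqP/val_inj.
  case/forall_inPn => i iB /forall_inPn [j jB]; rewrite negb_imply => /andP[/eqP fij ij].
  by apply: (det_eq_col ij) => k; rewrite !mxE (cB i j) // fij.
have [hA|hA] := leqP ('C(#|A|, 2)) (\sum_(j in A) f j); last first.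
  rewrite (H A) ?mulr0 ?scale0r ?dvdp0 // -?ltnNge //.
  by move=> i j iA jA; rewrite !cA iA jA.
have [hB|hB] := leqP ('C(#|~: A|, 2)) (\sum_(j in ~: A) f j); last first.
  rewrite (H (~: A)) ?mulr0 ?scale0r ?dvdp0 // -?ltnNge //.
  by move=> i j; rewrite !inE !cA => /negbTE-> /negbTE->.
rewrite -mul_polyC dvdp_mull // dvdp_exp2l //.
rewrite (bigID (mem A)) /=; apply: leq_add => //.
by rewrite (leq_trans hB) //; under [in X in (X <= _)%N]eq_bigl => j do rewrite inE.
Qed.

(** Only the choice of the leading term in every column reaches the degree [e], so the coefficient
    there is a product of leading coefficients and a Vandermonde-like determinant in the numbers
    [g_j + deg q_j]. *)
Lemma wronp_neq0 c n :
  (forall j, (j < n)%N -> (c j).2 != 0) ->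
  (forall i j, (i < n)%N -> (j < n)%N ->
     (c i).1 + (size (c i).2).-1%:R = (c j).1 + (size (c j).2).-1%:R -> i = j) ->
  wronp c n != 0.
Proof.
(* The successor makes ['I_D] inhabited, as [inord] requires. *)
move=> c0 cinj; pose D := (\max_(j < n) size (c j).2).+1.
have cD j : (j < n)%N -> (size (c j).2 <= D)%N.
  by move=> jn; rewrite leqW // (@leq_bigmax _ (fun j : 'I_n => size (c j).2) (Ordinal jn)).
pose e := (\sum_(j < n) (size (c j).2).-1)%N.
pose f0 : {ffun 'I_n -> 'I_D} := [ffun j : 'I_n => inord (size (c j).2).-1].
have f0E (j : 'I_n) : f0 j = (size (c j).2).-1 :> nat.
  by rewrite ffunE inordK // (leq_ltn_trans (leq_pred _)) // ltnS;
    exact: (@leq_bigmax _ (fun j : 'I_n => size (c j).2)).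
suff : (wronp c n)`_e != 0 by apply: contra => /eqP->; rewrite coef0.
rewrite (wronp_expand cD) coef_sum (bigD1 f0) //= [X in _ + X]big1 ?addr0 => [|f ff0].
  rewrite coefZ coefXn (_ : (\sum_(j < n) f0 j)%N = e); last exact: eq_bigr.
  rewrite eqxx mulr1 mulf_neq0 //.
    by rewrite prodf_seq_neq0; apply/allP => j _ /=; rewrite f0E -lead_coefE lead_coef_eq0 c0.
  under eq_mx => i j do rewrite f0E.
  by apply: det_ffall_neq0 => i j /cinj ij; apply/val_inj/ij.
rewrite coefZ coefXn; have [/forallP fs|] := boolP [forall j : 'I_n, (f j < size (c j).2)%N].
  case: eqP => [ee|]; last by rewrite mulr0.
  case/eqP: ff0; apply/ffunP => j; apply/val_inj; rewrite /= f0E.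
  have fle i : true -> (f i <= (size (c i).2).-1)%N by rewrite -ltnS (leq_trans (fs i)) // leqSpred.
  (* Equality case of a sum of inequalities: total degree [e] forces each [f j] to be maximal. *)
  have := leqif_sum (fun i h => leqif_eq (fle i h)).
  move=> [_]; rewrite -ee eqxx => /esym/forall_inP/(_ j isT)/eqP //.
rewrite negb_forall => /existsP[j]; rewrite -leqNgt => h.
by rewrite (bigD1 j) //= nth_default // !mul0r.
Qed.
End WronskianPolynomial.

(** * Bordered determinants and the derivative of a Wronskian *)

Lemma det_schur (F : fieldType) m n (A : 'M[F]_m) (B : 'M[F]_(m, n)) C (D : 'M[F]_n) :
  A \in unitmx ->
  \det (block_mx A B C D) = \det A * \det (D - C *m invmx A *m B).
Proof.
move=> uA.
have -> : block_mx A B C D =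
    block_mx 1%:M 0 (C *m invmx A) 1%:M *m block_mx A B 0 (D - C *m invmx A *m B).
  rewrite mulmx_block !mul1mx !mul0mx !addr0 mulmxKV //.
  by rewrite addrC subrK.
by rewrite det_mulmx det_lblock det_ublock !det1 !mul1r.
Qed.

Section Bordering.
Variable F : fieldType.
Implicit Type H : nat -> nat -> F.

Definition ndet n H : F := \det (\matrix_(i < n, j < n) H i j).

(** Meant for indices [i <= k] only: a minor of order [k.+1] then uses the indices
    [0, ..., k-1, k+1]. *)
Definition skip k i : nat := if i == k then k.+1 else i.

(** Besides the leading block, [S p q] involves only row [p] and column [q] of [H], so one matrix
    [S] describes all minors bordering that block. *)
Lemma ndet_schur H k m :
  ndet k H != 0 ->
  let A := \matrix_(i < k, j < k) H i j in
  let S p q := H p q -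
    \sum_(j < k) (\sum_(i < k) H p i * invmx A i j) * H j q in
  ndet (k + m) H = ndet k H * \det (\matrix_(i < m, j < m) S (k + i)%N (k + j)%N).
Proof.
move=> H0 A S; rewrite /ndet.
have -> : \matrix_(i < k + m, j < k + m) H i j =
    block_mx A (\matrix_(i, j) H i (k + j)%N) (\matrix_(i, j) H (k + i)%N j)
      (\matrix_(i, j) H (k + i)%N (k + j)%N).
  apply/matrixP => i j; rewrite !mxE.
  by case: splitP => i' ->; rewrite mxE; case: splitP => j' ->; rewrite mxE.
rewrite det_schur; last by rewrite unitmxE unitfE.
congr (_ * \det _); apply/matrixP => i j; rewrite !mxE /S; congr (_ - _).
apply: eq_bigr => l _; rewrite !mxE; congr (_ * _).
by apply: eq_bigr => l' _; rewrite !mxE.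
Qed.

(* Desnanot-Jacobi: all four minors on the right are bordered by the one on the
   left, so each is that one times an entry of its Schur complement. *)
Lemma desnanot_jacobi H k : ndet k H != 0 ->
  ndet k H * ndet k.+2 H =
  ndet k.+1 H * ndet k.+1 (fun i j => H (skip k i) (skip k j)) -
  ndet k.+1 (fun i j => H i (skip k j)) * ndet k.+1 (fun i j => H (skip k i) j).
Proof.
move=> H0.
have sk (i : 'I_k) : skip k i = i by rewrite /skip ltn_eqF.
have skk : skip k k = k.+1 by rewrite /skip eqxx.
pose A := \matrix_(i < k, j < k) H i j.
pose S p q := H p q - \sum_(j < k) (\sum_(i < k) H p i * invmx A i j) * H j q.
have H1 (u v : nat -> nat) : (forall i : 'I_k, u i = i) -> (forall i : 'I_k, v i = i) ->
    ndet k.+1 (fun i j => H (u i) (v j)) = ndet k H * S (u k) (v k).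
  move=> uE vE; have eA : \matrix_(i < k, j < k) H (u i) (v j) = A.
    by apply/matrixP => i j; rewrite !mxE uE vE.
  have eH : ndet k (fun i j => H (u i) (v j)) = ndet k H by rewrite /ndet eA.
  rewrite -addn1 ndet_schur ?eH // eA det_mx11 mxE !addn0; congr (_ * _).
  rewrite /S; congr (_ - _); apply: eq_bigr => j _; rewrite uE; congr (_ * _).
  by apply: eq_bigr => i _; rewrite vE.
rewrite -addn2 ndet_schur // (H1 id id) // (H1 (skip k) (skip k)) //.
rewrite (H1 id (skip k)) // (H1 (skip k) id) // skk.
rewrite (expand_det_row _ 0) !big_ord_recl big_ord0 /cofactor !det_mx11 !mxE /=.
rewrite /bump /= !addn0 !addn1 /S /A; ring.
Qed.
End Bordering.

Section DerivDet.
Variable A : comNzRingType.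

Lemma deriv_prod_ord n (F : 'I_n -> {poly A}) :
  (\prod_i F i)^`() = \sum_l (F l)^`() * \prod_(i | i != l) F i.
Proof.
transitivity (\sum_l \prod_i (if i == l then (F i)^`() else F i)); last first.
  apply: eq_bigr => l _; rewrite (bigD1 l) //= eqxx; congr (_ * _).
  by apply: eq_bigr => i /negbTE->.
elim: n F => [|n IH] F; first by rewrite !big_ord0 derivC.
rewrite big_ord_recl derivM IH [RHS]big_ord_recl; congr (_ + _).
  by rewrite big_ord_recl.
rewrite mulr_sumr; apply: eq_bigr => l _; rewrite big_ord_recl /=; congr (_ * _).
Qed.

Definition row_repl n (M : 'M[{poly A}]_n) l (v : 'I_n -> {poly A}) :=
  \det (\matrix_(i, j) (if i == l then v j else M i j)).

Lemma row_replE n (M : 'M[{poly A}]_n) l v :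
  row_repl M l v =
  \sum_(s : 'S_n) (-1) ^+ s * (v (s l) * \prod_(i | i != l) M i (s i)).
Proof.
apply: eq_bigr => s _; rewrite (bigD1 l) //= mxE eqxx; congr (_ * (_ * _)).
by apply: eq_bigr => i /negbTE il; rewrite mxE il.
Qed.

Lemma deriv_det n (M : 'M[{poly A}]_n) :
  (\det M)^`() = \sum_l row_repl M l (fun j => (M l j)^`()).
Proof.
under [RHS]eq_bigr => l _ do rewrite row_replE.
rewrite exchange_big /= raddf_sum; apply: eq_bigr => s _.
rewrite -mulr_sumr -(deriv_prod_ord (fun i => M i (s i))) !mulr_sign.
by case: ifP => _; rewrite /= ?derivN.
Qed.

(** In the term of a permutation [s] the replacements contribute the sum of [g (s l)] over [l],
    which does not depend on [s]. This is the infinitesimal action of a diagonal matrix, which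
    multiplies a determinant by its trace. *)
Lemma sum_row_repl_scale n (M : 'M[{poly A}]_n) (g : 'I_n -> {poly A}) :
  \sum_l row_repl M l (fun j => g j * M l j) = (\sum_j g j) * \det M.
Proof.
under eq_bigr => l _ do rewrite row_replE.
rewrite exchange_big /= mulr_sumr; apply: eq_bigr => s _.
rewrite -mulr_sumr mulrCA; congr (_ * _).
rewrite [in RHS](reindex_inj (@perm_inj _ s)) /= mulr_suml; apply: eq_bigr => l _.
by rewrite -mulrA [in RHS](bigD1 l).
Qed.
End DerivDet.

Section WronskianDerivative.
Variable R : fieldType.
Implicit Types (c : nat -> R * {poly R}).

(* [t d/dt] sends row [i] to row [i.+1] up to a diagonal part, and row [i.+1] is
   already present unless [i] is the last one. *)
Lemma deriv_wronp c n :
  'X * (wronp c n.+1)^`() =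
  \det (\matrix_(i < n.+1, j < n.+1) tderiv (c j) (skip n i)) -
  (\sum_(j < n.+1) (c j).1 - \sum_(i < n.+1) i%:R) *: wronp c n.+1.
Proof.
rewrite /wronp; set M := \matrix_(_, _) _.
rewrite deriv_det mulr_sumr.
have E (l : 'I_n.+1) : 'X * row_repl M l (fun j => (M l j)^`()) =
  row_repl M l (fun j => tderiv (c j) l.+1) -
  row_repl M l (fun j => ((c j).1)%:P * M l j) + (l%:R)%:P * \det M.
  have -> : \det M = row_repl M l (M l).
    by congr (\det _); apply/matrixP => i j; rewrite [RHS]mxE; case: eqP => // ->.
  rewrite !row_replE !mulr_sumr -sumrB -big_split; apply: eq_bigr => s _ /=.
  rewrite tderivS !mxE -[_ *: tderiv _ _]mul_polyC polyCB.
  move: ((-1) ^+ s) (\prod_(_ | _) _) => e p.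
  move: (tderiv _ l)^`() => d; move: (tderiv _ l) => q.
  move: ((c (s l)).1%:P) ((l%:R)%:P) 'X => a b X.
  by ring.
under eq_bigr => l _ do rewrite E.
rewrite big_split sumrB /= (sum_row_repl_scale M (fun j => ((c j).1)%:P)).
rewrite big_ord_recr /= big1 => [|l _]; last first.
  apply: (@determinant_alternate _ _ _ (widen_ord (leqnSn n) l) (lift ord0 l)).
    by rewrite -val_eqE /= /bump /=; lia.
  move=> j; rewrite !mxE eqxx; case: eqP => // /(congr1 val) /=; rewrite /bump /=; lia.
rewrite add0r -mul_polyC polyCB !rmorph_sum /= -mulr_suml.
have -> : row_repl M ord_max (fun j => tderiv (c j) n.+1) =
    \det (\matrix_(i < n.+1, j < n.+1) tderiv (c j) (skip n i)).
  congr (\det _); apply/matrixP => i j; rewrite !mxE /skip -val_eqE /=.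
  by case: eqP.
by rewrite mulrBl opprB addrAC addrA.
Qed.
End WronskianDerivative.

(** * Zeros of Wronskians *)

Section PointwiseDerivatives.
Variable R : realType.
Implicit Types (f g : R -> R) (x k : R).

Lemma is_derive_mul f g x a b : is_derive x 1 f a -> is_derive x 1 g b ->
  is_derive x 1 (fun y => f y * g y) (a * g x + f x * b).
Proof.
move=> fa gb; apply: (is_derive_eq (is_deriveM fa gb)).
by rewrite /GRing.scale /= addrC mulrC.
Qed.

Lemma is_derive_const k x : is_derive x 1 (fun=> k) 0.
Proof. exact: is_derive_cst. Qed.

Lemma is_derive_var x : is_derive x 1 (fun y : R => y) 1.
Proof. exact: is_derive_id. Qed.

Lemma is_derive_add f g x a b : is_derive x 1 f a -> is_derive x 1 g b ->
  is_derive x 1 (fun y => f y + g y) (a + b).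
Proof. by move=> fa gb; exact: is_deriveD. Qed.

Lemma is_derive_sub f g x a b : is_derive x 1 f a -> is_derive x 1 g b ->
  is_derive x 1 (fun y => f y - g y) (a - b).
Proof. by move=> fa gb; exact: is_deriveB. Qed.

Lemma is_derive_scale k f x a : is_derive x 1 f a ->
  is_derive x 1 (fun y => k * f y) (k * a).
Proof. by move=> fa; exact: is_deriveZ. Qed.

Lemma is_derive_comp f g x a b : is_derive x 1 g b -> is_derive (g x) 1 f a ->
  is_derive x 1 (fun y => f (g y)) (a * b).
Proof. by move=> gb fa; exact: is_derive1_comp. Qed.

Lemma is_derive_within_continuous f df a b :
  (forall x, a <= x <= b -> is_derive x 1 f (df x)) ->
  {within `[a, b], continuous f}.
Proof.
by move=> fd; apply: derivable_within_continuous => x; rewrite in_itv /= => /fd[].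
Qed.

Lemma mvt_is_derive f df a b : a < b ->
  (forall x, a <= x <= b -> is_derive x 1 f (df x)) ->
  exists2 c, a < c < b & f b - f a = df c * (b - a).
Proof.
move=> ab fd; have [] := @MVT R f df a b ab.
- by move=> x; rewrite in_itv /= => /andP[ax xb]; apply: fd; rewrite !ltW.
- exact: is_derive_within_continuous fd.
- by move=> c; rewrite in_itv /= => cab; exists c.
Qed.
End PointwiseDerivatives.

Section WronskianZeros.
Variable R : realType.
Implicit Types (c : nat -> R * {poly R}) (p q : {poly R}) (a b e u v x : R).

(** Rolle for [t^e p / q], whose derivative is [t^(e-1) / q^2] times the expression in the
    conclusion. The factor [t^e] restores the powers of [t] that [wronp] leaves out. *)
Lemma rolle_quotient p q e a b : 0 < a -> a < b -> p.[a] = 0 -> p.[b] = 0 ->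
  (forall x, a <= x <= b -> q.[x] != 0) ->
  exists2 x, a < x < b &
    q.[x] * (x * p^`().[x] + e * p.[x]) - p.[x] * (x * q^`().[x]) = 0.
Proof.
move=> a0 ab pa pb q0.
pose h x := x `^ e * p.[x] * (q.[x])^-1.
have xgt0 x : a <= x <= b -> 0 < x by move=> /andP[ax _]; exact: lt_le_trans ax.
have [|x axb] := @mvt_is_derive R h
  (fun x => x `^ (e - 1) / q.[x] ^+ 2 *
     (q.[x] * (x * p^`().[x] + e * p.[x]) - p.[x] * (x * q^`().[x]))) a b ab.
  move=> x axb.
  have d1 := is_derive_mul (is_derive1_powR e (xgt0 x axb)) (is_derive_poly p x).
  have d2 : is_derive x 1 (fun y => (q.[y])^-1) (- q.[x] ^- 2 * q^`().[x]).
    exact: (is_derive_eq (@is_deriveV R (horner q) x _ 1 (q0 x axb) (is_derive_poly q x))).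
  apply: (is_derive_eq (is_derive_mul d1 d2)).
  have xe : x `^ e = x * x `^ (e - 1).
    have x0 := xgt0 x axb.
    rewrite -[X in X * _](powRr1 (ltW x0)) -powRD; first by congr (_ `^ _); ring.
    by apply/implyP => _; rewrite gt_eqF.
  by rewrite xe; field; exact: q0.
rewrite /h pa pb !(mulr0, mul0r) subrr => /esym/eqP.
have axb' : a <= x <= b by case/andP: axb => *; rewrite !ltW.
rewrite mulf_eq0 [b - a == 0]subr_eq0 (gt_eqF ab) orbF mulf_eq0.
rewrite mulf_eq0 invr_eq0 expf_eq0 /= (negbTE (q0 x axb')).
by rewrite gt_eqF ?powR_gt0 ?xgt0 //= => /eqP ?; exists x.
Qed.

Lemma eq_wronp c1 c2 n : (forall j, (j < n)%N -> c1 j = c2 j) ->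
  wronp c1 n = wronp c2 n.
Proof.
by move=> ec; congr (\det _); apply/matrixP => i j; rewrite !mxE ec.
Qed.

Lemma horner_wronp_det n (M : 'M[{poly R}]_n) x :
  (\det M).[x] = \det (\matrix_(i, j) (M i j).[x]).
Proof.
rewrite -horner_evalE -det_map_mx; congr (\det _).
by apply/matrixP => i j; rewrite !mxE.
Qed.

(** The Wronskian identity behind Rolle, free of powers of [t]: in Desnanot-Jacobi the two minors
    with a skipped row are rewritten by [deriv_wronp]. The sums over the row indices cancel, and the
    sums of the column exponents differ by one term only. *)
Lemma wronp_step c k x : (wronp c k).[x] != 0 ->
  let P := wronp (fun j => c (skip k j)) k.+1 in
  let Q := wronp c k.+1 in
  (wronp c k).[x] * (wronp c k.+2).[x] =
  Q.[x] * (x * P^`().[x] + ((c k.+1).1 - (c k).1) * P.[x]) -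
  P.[x] * (x * Q^`().[x]).
Proof.
pose H i j := (tderiv (c j) i).[x].
have wE n : (wronp c n).[x] = ndet n H.
  by rewrite horner_wronp_det; congr (\det _); apply/matrixP => i j; rewrite !mxE.
move=> + P Q; rewrite !wE => /desnanot_jacobi ->.
have QE : Q.[x] = ndet k.+1 H by rewrite -wE.
have PE : P.[x] = ndet k.+1 (fun i j => H i (skip k j)).
  by rewrite horner_wronp_det; congr (\det _); apply/matrixP => i j; rewrite !mxE.
have ev (p1 p2 : {poly R}) : p1 = p2 -> p1.[x] = p2.[x] by move->.
have dQ := ev _ _ (deriv_wronp c k).
rewrite -/Q hornerM hornerX hornerD hornerN hornerZ horner_wronp_det QE in dQ.
rewrite {}dQ.
have dP := ev _ _ (deriv_wronp (fun j => c (skip k j)) k).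
rewrite -/P hornerM hornerX hornerD hornerN hornerZ horner_wronp_det PE in dP.
rewrite {}dP PE.
have -> : \matrix_(i, j) ((\matrix_(i < k.+1, j < k.+1) tderiv (c j) (skip k i)) i j).[x]
  = \matrix_(i < k.+1, j < k.+1) H (skip k i) j by apply/matrixP => i j; rewrite !mxE.
have -> : \matrix_(i, j) ((\matrix_(i < k.+1, j < k.+1)
      tderiv (c (skip k j)) (skip k i)) i j).[x]
  = \matrix_(i < k.+1, j < k.+1) H (skip k i) (skip k j).
  by apply/matrixP => i j; rewrite !mxE.
rewrite -/(ndet k.+1 (fun i j => H (skip k i) j)).
rewrite -/(ndet k.+1 (fun i j => H (skip k i) (skip k j))).
have sE : \sum_(j < k.+1) (c (skip k j)).1 =
    \sum_(j < k.+1) (c j).1 + (c k.+1).1 - (c k).1.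
  rewrite !big_ord_recr /= /skip eqxx.
  under eq_bigr => i _ do rewrite ltn_eqF //.
  by rewrite [RHS]addrAC addrK.
rewrite sE; ring.
Qed.

Definition zeros_in p (u v : R) (s : seq R) :=
  uniq s && all (fun x => (u < x < v) && root p x) s.

(** With size [k.+1] this encodes [Wr[f_1, ..., f_k, g]]: each step of the chain inserts a seed in
    column [k] and pushes [g] one place to the right. *)
Definition last_col c k (g : R * {poly R}) j := if j == k then g else c j.

(** Rolle is applied to the quotient of [P] by the zero-free [wronp c k.+1] between consecutive
    zeros. By [wronp_step] the point found is a zero of [wronp c k] times the next Wronskian, and
    the first factor does not vanish. *)
Lemma zeros_step c k g u v s : 0 <= u ->
  (forall x, u < x < v -> (wronp c k).[x] != 0) ->
  (forall x, u < x < v -> (wronp c k.+1).[x] != 0) ->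
  zeros_in (wronp (last_col c k g) k.+1) u v s ->
  exists2 s', zeros_in (wronp (last_col c k.+1 g) k.+2) u v s' &
    (size s <= (size s').+1)%N.
Proof.
move=> u0 W0 W1 /andP[us sz].
pose P := wronp (last_col c k g) k.+1.
pose P' := wronp (last_col c k.+1 g) k.+2.
have E0 : wronp (last_col c k.+1 g) k = wronp c k.
  by apply: eq_wronp => j jk; rewrite /last_col ltn_eqF // ltnW.
have E1 : wronp (last_col c k.+1 g) k.+1 = wronp c k.+1.
  by apply: eq_wronp => j jk; rewrite /last_col ltn_eqF.
have E2 : wronp (fun j => last_col c k.+1 g (skip k j)) k.+1 = P.
  apply: eq_wronp => j jk; rewrite /last_col /skip.
  by have [_|_] := eqVneq j k; rewrite ?eqxx // ltn_eqF.
have step x y : u < x -> x < y -> y < v -> root P x -> root P y ->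
    exists2 z, x < z < y & root P' z.
  move=> ux xy yv /rootP Px /rootP Py.
  have [||z xzy] := @rolle_quotient P (wronp c k.+1)
    ((last_col c k.+1 g k.+1).1 - (last_col c k.+1 g k).1) x y _ xy Px Py.
  - exact: le_lt_trans ux.
  - move=> z /andP[xz zy]; apply: W1.
    by rewrite (lt_le_trans ux xz) (le_lt_trans zy yv).
  have uzv : u < z < v by case/andP: xzy => xz zy; rewrite (lt_trans ux xz) (lt_trans zy yv).
  have /wronp_step : (wronp (last_col c k.+1 g) k).[z] != 0 by rewrite E0 W0.
  rewrite E0 E1 E2 => <- /eqP; rewrite mulf_eq0 (negbTE (W0 _ uzv)) /= => Pz.
  by exists z.
have aux t x : path <%R x t -> all (fun x => (u < x < v) && root P x) (x :: t) ->
   exists s', [/\ path <%R x s', all (fun x => (u < x < v) && root P' x) s'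
               & size s' = size t].
  elim: t x => [|y t IH] x; first by exists [::].
  move=> /= /andP[xy yt] /andP[/andP[/andP[ux xv] rx]].
  move=> /= yall; have [s' [ys' as' ss']] := IH y yt yall.
  case/andP: yall => /andP[/andP[uy yv] ry] _.
  have [z /andP[xz zy] rz] := step x y ux xy yv rx ry.
  exists (z :: s'); split => /=.
  - by rewrite xz (path_le lt_trans zy).
  - by rewrite (lt_trans ux xz) (lt_trans zy yv) rz.
  - by rewrite ss'.
have := permEl (perm_sort <=%R s).
set t := sort _ s => pts.
have tu : uniq t by rewrite (perm_uniq pts).
have tall : all (fun x => (u < x < v) && root P x) t by rewrite (perm_all _ pts).
have tst : sorted <%R t by rewrite lt_sorted_uniq_le tu sort_le_sorted.
rewrite -(perm_size pts).
case: t tst tall {pts tu} => [|x t] /= pt tall; first by exists [::].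
have [s' [ps' as' ss']] := aux t x pt tall.
exists s'; last by rewrite ss'.
rewrite /zeros_in as' andbT; apply: (sorted_uniq lt_trans ltxx).
exact: path_sorted ps'.
Qed.

Lemma zeros_chain c r g u v s : 0 <= u ->
  (forall k x, (k <= r)%N -> u < x < v -> (wronp c k).[x] != 0) ->
  zeros_in g.2 u v s ->
  exists2 s', zeros_in (wronp (last_col c r g) r.+1) u v s' &
    (size s <= size s' + r)%N.
Proof.
move=> u0; elim: r => [|r IH] W0 gs.
  exists s; last by rewrite addn0.
  rewrite /wronp det_mx11 mxE /last_col eqxx tderiv0; exact: gs.
have [s' zs' ss'] := IH (fun k x kr => W0 k x (leqW kr)) gs.
have [s'' zs'' ss''] :=
  zeros_step u0 (fun x => W0 r x (leqnSn r)) (fun x => W0 r.+1 x (leqnn _)) zs'.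
by exists s'' => //; lia.
Qed.

(** Loss when [m] exceptional points may have to be avoided: cutting at one of them may lose a zero
    there and leaves two intervals, each with at most [m - 1] exceptional points. The bound is
    crude; only its independence of [g] matters. *)
Fixpoint split_loss r m : nat := if m is m'.+1 then (split_loss r m').*2.+1 else r.

Lemma zeros_in_split p u v w s : zeros_in p u v s ->
  exists s1 s2, [/\ zeros_in p u w s1, zeros_in p w v s2 &
    (size s <= (size s1 + size s2).+1)%N].
Proof.
move=> /andP[us sall].
exists [seq x <- s | (x < w)%R], [seq x <- s | (w < x)%R]; split.
- rewrite /zeros_in filter_uniq //=; apply/allP => x; rewrite mem_filter => /andP[xw xs].
  by have /allP/(_ x xs)/andP[/andP[-> _] ->] := sall; rewrite xw.
- rewrite /zeros_in filter_uniq //=; apply/allP => x; rewrite mem_filter => /andP[xw xs].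
  by have /allP/(_ x xs)/andP[/andP[_ ->] ->] := sall; rewrite xw.
rewrite !size_filter -(count_predC (fun x => x < w)%R s) -addnS leq_add2l.
have -> : count (predC (fun x => x < w)%R) s = (count (fun x => w < x)%R s + count_mem w s)%N.
  have -> : count (predC (fun x => x < w)%R) s =
      count (predU (fun x => w < x)%R (pred1 w)) s.
    by apply: eq_count => x /=; rewrite -leNgt le_eqVlt eq_sym orbC.
  rewrite -(count_predUI (fun x => w < x)%R (pred1 w)).
  rewrite [X in (_ + X)%N](_ : _ = 0)%N ?addn0 //.
  apply/eqP; rewrite -leqn0 leqNgt -has_count; apply/hasPn => x _ /=.
  by apply/negP => /andP[wx /eqP xw]; rewrite xw ltxx in wx.
by rewrite count_uniq_mem // -addn1 leq_add2l leq_b1.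
Qed.

Lemma zeros_wronp c r g (B : seq R) u v s : 0 <= u ->
  (forall k x, (k <= r)%N -> u < x < v -> x \notin B -> (wronp c k).[x] != 0) ->
  zeros_in g.2 u v s ->
  exists2 s', zeros_in (wronp (last_col c r g) r.+1) u v s' &
    (size s <= size s' + split_loss r (size B))%N.
Proof.
elim: B u v s => [|w B IH] u v s u0 W0 gs.
  by apply: zeros_chain gs => // k x kr uxv; apply: W0.
have [/andP[uw wv]|nw] := boolP (u < w < v).
  have [s1 [s2 [z1 z2 ss]]] := zeros_in_split w gs.
  have [|s1' z1' ss1] := IH u w s1 u0 _ z1.
    move=> k x kr /andP[ux xw] xB; apply: W0 => //; first by rewrite ux (lt_trans xw).
    by rewrite inE lt_eqF.
  have [|s2' z2' ss2] := IH w v s2 (le_trans u0 (ltW uw)) _ z2.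
    move=> k x kr /andP[wx xv] xB; apply: W0 => //; first by rewrite xv (lt_trans uw).
    by rewrite inE gt_eqF.
  exists (s1' ++ s2'); last by rewrite size_cat /= -addnn; lia.
  case/andP: z1' => u1 /allP a1; case/andP: z2' => u2 /allP a2.
  rewrite /zeros_in cat_uniq u1 u2 all_cat andbT /=; apply/and3P; split.
  - apply/hasPn => x /a2/andP[/andP[wx _] _]; apply/negP => /a1/andP[/andP[_ xw] _].
    by move: (lt_trans xw wx); rewrite ltxx.
  - by apply/allP => x /a1/andP[/andP[-> xw] ->]; rewrite (lt_trans xw).
  - by apply/allP => x /a2/andP[/andP[wx ->] ->]; rewrite (lt_trans uw).
have [|s' zs' ss'] := IH u v s u0 _ gs.
  move=> k x kr uxv xB; apply: W0 => //; rewrite inE negb_or xB andbT.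
  by apply: contra nw => /eqP <-.
by exists s' => //=; lia.
Qed.
End WronskianZeros.

(** * Zeros of Jacobi polynomials *)

Section JacobiAlgebra.
Variable R : realType.
Implicit Types (a b al be : R).

Lemma gbinom0 a : gbinom a 0 = 1.
Proof. by rewrite /gbinom big_ord0 fact0 divr1. Qed.

Lemma gbinomS a k : gbinom a k.+1 * k.+1%:R = gbinom a k * (a - k%:R).
Proof.
rewrite /gbinom big_ord_recr factS natrM /=.
have k0 : (k`!)%:R != 0 :> R by rewrite pnatr_eq0 -lt0n fact_gt0.
have k1 : k.+1%:R != 0 :> R by rewrite pnatr_eq0.
move: (\prod_(_ < _) _) => p; field; exact/andP.
Qed.

Lemma gbinom_neq0 a k : (forall i, (i < k)%N -> a <> i%:R) -> gbinom a k != 0.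
Proof.
move=> ak; rewrite /gbinom mulf_neq0 ?invr_eq0 ?pnatr_eq0 -?lt0n ?fact_gt0 //.
rewrite prodf_seq_neq0; apply/allP => i _ /=; rewrite subr_eq0; apply/eqP.
exact: ak.
Qed.

(** Induction: multiply by [n + 1 = j + (n + 1 - j)] and absorb each summand by [gbinomS]. The two
    shifted sums recombine with factor [(a - j) + (b - (n - j)) = a + b - n]. *)
Lemma gbinom_Vandermonde a b n :
  \sum_(j < n.+1) gbinom a j * gbinom b (n - j) = gbinom (a + b) n.
Proof.
elim: n => [|n IH]; first by rewrite big_ord_recl big_ord0 subn0 !gbinom0; ring.
have n0 : n.+1%:R != 0 :> R by rewrite pnatr_eq0.
apply: (mulIf n0); rewrite gbinomS -IH !mulr_suml.
transitivity (\sum_(j < n.+2) gbinom a j * j%:R * gbinom b (n.+1 - j) +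
              \sum_(j < n.+2) gbinom a j * (gbinom b (n.+1 - j) * (n.+1 - j)%N%:R)).
  rewrite -big_split /=; apply: eq_bigr => j _.
  have -> : n.+1%:R = j%:R + (n.+1 - j)%:R :> R by rewrite -natrD subnKC // -ltnS.
  by ring.
rewrite big_ord_recl /= mulr0 mul0r add0r.
rewrite [X in _ + X]big_ord_recr /= subnn !mulr0 addr0 -big_split /=.
apply: eq_bigr => j _; have jn : (j <= n)%N by rewrite -ltnS.
rewrite /bump /= add1n gbinomS subSS subSn // gbinomS natrB //; ring.
Qed.

Lemma size_monic_jacobi_term n (j : 'I_n.+1) :
  (('X - 1) ^+ (n - j) * ('X + 1) ^+ j : {poly R}) \is monic /\
  size (('X - 1) ^+ (n - j) * ('X + 1) ^+ j : {poly R}) = n.+1.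
Proof.
have m1 : ('X - 1 : {poly R}) \is monic by exact: monicXsubC.
have m2 : ('X + 1 : {poly R}) \is monic by exact: monicXaddC.
split; first by rewrite monicMr ?monic_exp.
rewrite size_monicM ?monic_exp ?monic_neq0 ?monic_exp //.
rewrite !size_exp_XsubC.
have -> : ('X + 1 : {poly R}) = 'X - (-1)%:P by rewrite polyCN opprK.
by rewrite size_exp_XsubC addnS /= addSn subnK // -ltnS.
Qed.

(** By Vandermonde the coefficient of degree [n] is, up to a power of 2, [gbinom (2n + al + be) n].
    It vanishes when [2n + al + be] is some [i < n], and [k = n - i] turns this into the excluded
    equation. *)
Lemma size_jacobi al be n :
  (forall k, (1 <= k <= n)%N -> al + be + n%:R <> - k%:R) ->
  size (jacobi al be n) = n.+1.
Proof.
move=> hn; rewrite /jacobi size_scale; last first.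
  by rewrite invr_eq0 expf_neq0 // pnatr_eq0.
set p := \sum_(_ < _) _.
have sp : (size p <= n.+1)%N.
  apply: (leq_trans (size_sum _ _ _)); apply/bigmax_leqP => j _.
  by rewrite (leq_trans (size_scale_leq _ _)) // (size_monic_jacobi_term j).2.
apply/eqP; rewrite eqn_leq sp /=; rewrite ltnNge; apply/negP => sn.
have : p`_n = 0 by rewrite nth_default.
rewrite coef_sum (eq_bigr (fun j : 'I_n.+1 =>
  gbinom (n%:R + al) j * gbinom (n%:R + be) (n - j))) => [|j _]; last first.
  rewrite coefZ; have [/monicP] := size_monic_jacobi_term j.
  by rewrite lead_coefE => + s; rewrite s /= => ->; rewrite mulr1.
rewrite gbinom_Vandermonde; apply/eqP/gbinom_neq0 => i iN ei.
apply: (hn (n - i)%N); first by rewrite subn_gt0 iN leq_subr.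
by rewrite natrB; [move: ei; lra | exact: ltnW].
Qed.

(** The operator [L] sends [(x-1)^i (x+1)^j], [i + j = n], to a combination of itself and its two
    neighbours of the same total degree. With the weights [c j] the exchanges between neighbours
    balance, and the sum telescopes to 0. *)
Lemma jacobi_ode al be n (p := jacobi al be n) :
  (1 - 'X ^+ 2) * p^`()^`() + ((be - al)%:P - (al + be + 2)%:P * 'X) * p^`() +
  (n%:R * (n%:R + al + be + 1))%:P * p = 0.
Proof.
pose a : {poly R} := 'X - 1; pose b : {poly R} := 'X + 1.
pose L (q : {poly R}) := (1 - 'X ^+ 2) * q^`()^`() +
  ((be - al)%:P - (al + be + 2)%:P * 'X) * q^`() +
  (n%:R * (n%:R + al + be + 1))%:P * q.
have LD q1 q2 : L (q1 + q2) = L q1 + L q2 by rewrite /L !derivD; ring.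
have L0 : L 0 = 0 by rewrite /L !deriv0; ring.
have LZ k q : L (k *: q) = k *: L q.
  by rewrite /L !derivZ -!mul_polyC; ring.
have da i : a * (a ^+ i)^`() = i%:R%:P * a ^+ i.
  rewrite /a deriv_exp derivB derivX derivC subr0 mul1r polyC_natr.
  by case: i => [|i]; rewrite ?mulr0n ?mulr0 ?mul0r // -mulr_natl mulrCA -exprS.
have db i : b * (b ^+ i)^`() = i%:R%:P * b ^+ i.
  rewrite /b deriv_exp derivD derivX derivC addr0 mul1r polyC_natr.
  by case: i => [|i]; rewrite ?mulr0n ?mulr0 ?mul0r // -mulr_natl mulrCA -exprS.
have dda i : a * (a ^+ i)^`()^`() = (i%:R - 1)%:P * (a ^+ i)^`().
  have := congr1 (@deriv R) (da i); rewrite !derivM derivB derivX !derivC subr0 mul0r.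
  rewrite add0r mul1r => e; apply: (addrI (a ^+ i)^`()); rewrite e polyCB.
  by move: (_ ^+ i)^`() => d; ring.
have ddb i : b * (b ^+ i)^`()^`() = (i%:R - 1)%:P * (b ^+ i)^`().
  have := congr1 (@deriv R) (db i); rewrite !derivM derivD derivX !derivC addr0 mul0r.
  rewrite add0r mul1r => e; apply: (addrI (b ^+ i)^`()); rewrite e polyCB.
  by move: (_ ^+ i)^`() => d; ring.
pose c (j : nat) : R := gbinom (n%:R + al) j * gbinom (n%:R + be) (n - j).
(* Derivatives are left unevaluated, so that the exponents 0 need no separate treatment. *)
have LE i j : (i + j)%N = n -> L (a ^+ i * b ^+ j) =
    (i%:R * (i%:R + al)) *: (a ^+ i * b ^+ j) - (i%:R + al) *: (b * (a ^+ i)^`() * b ^+ j)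
  + ((j%:R * (j%:R + be)) *: (a ^+ i * b ^+ j) - (j%:R + be) *: (a * a ^+ i * (b ^+ j)^`())).
  move=> ij; rewrite /L -ij natrD !derivM !derivD !derivM.
  have e1 : 1 - 'X ^+ 2 = - (a * b) by rewrite /a /b; ring.
  have e2 : (be - al)%:P - (al + be + 2)%:P * 'X = - ((al + 1)%:P * b + (be + 1)%:P * a).
    rewrite /a /b !polyCD polyCN ?polyC_natr !polyC1.
    by move: al%:P be%:P => x y; ring.
  rewrite e1 e2 -!mul_polyC.
  move: (da i) (db j) (dda i) (ddb j).
  move: (a ^+ i)^`()^`() (b ^+ j)^`()^`() => A2 B2.
  move: (a ^+ i)^`() (b ^+ j)^`() => A1 B1.
  move: (a ^+ i) (b ^+ j) => A B hA1 hB1 hA2 hB2.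
  transitivity (- (b * (a * A2) * B + 2 * (a * A1) * (b * B1) + a * A * (b * B2))
    - ((al + 1)%:P * (b * A1 * B + A * (b * B1)) + (be + 1)%:P * ((a * A1) * B + a * A * B1))
    + ((i%:R + j%:R) * (i%:R + j%:R + al + be + 1))%:P * (A * B)); first by ring.
  rewrite hA1 hB1 hA2 hB2 !(polyCD, polyCM, polyCN); ring.
rewrite -/(L p) /p /jacobi LZ (big_morph L LD L0).
under eq_bigr => j _ do rewrite LZ (LE (n - j)%N j (subnK (ltnSE (ltn_ord j)))).
pose K (j : nat) := c j * ((n - j)%N%:R * ((n - j)%N%:R + al)).
(* The balance relation: what term [j] passes to term [j + 1] equals what it receives back. *)
have KE j : (j < n)%N -> K j = c j.+1 * (j.+1%:R * (j.+1%:R + be)).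
  move=> jn; rewrite /K /c -(subnSK jn).
  have -> : (n - j.+1).+1%:R + al = n%:R + al - j%:R :> R.
    by rewrite subnSK // natrB 1?ltnW //; ring.
  have := gbinomS (n%:R + be) (n - j.+1).
  have -> : n%:R + be - (n - j.+1)%:R = j.+1%:R + be :> R by rewrite natrB //; ring.
  move=> e2; have e1 := gbinomS (n%:R + al) j.
  rewrite [RHS](_ : _ = (gbinom (n%:R + al) j.+1 * j.+1%:R) *
    (gbinom (n%:R + be) (n - j.+1) * (j.+1%:R + be))); last by ring.
  by rewrite e1 -e2; ring.
apply/eqP; rewrite scaler_eq0; apply/orP; right; apply/eqP.
pose T j : {poly R} := K j *: (a ^+ (n - j.+1) * b ^+ j.+1).
pose U j : {poly R} := K j *: (a ^+ (n - j) * b ^+ j).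
have aS m : (a ^+ m.+1)^`() = m.+1%:R *: a ^+ m.
  by rewrite deriv_exp /a derivB derivX derivC subr0 mul1r scaler_nat.
have bS m : (b ^+ m.+1)^`() = m.+1%:R *: b ^+ m.
  by rewrite deriv_exp /b derivD derivX derivC addr0 mul1r scaler_nat.
transitivity (\sum_(j < n.+1) ((K j *: (a ^+ (n - j) * b ^+ j) -
     (c j * ((n - j)%:R + al)) *: (b * (a ^+ (n - j))^`() * b ^+ j)) +
   ((c j * (j%:R * (j%:R + be))) *: (a ^+ (n - j) * b ^+ j) -
     (c j * (j%:R + be)) *: (a * a ^+ (n - j) * (b ^+ j)^`())))).
  by apply: eq_bigr => j _; rewrite -/(c j) scalerDr !scalerBr !scalerA.
rewrite big_split !sumrB /=.
have S1 : \sum_(j < n.+1) (c j * ((n - j)%:R + al)) *: (b * (a ^+ (n - j))^`() * b ^+ j) =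
    \sum_(j < n) T j.
  rewrite big_ord_recr /= subnn expr0 derivC mulr0 mul0r scaler0 addr0.
  apply: eq_bigr => j _; rewrite /T -(subnSK (ltn_ord j)) aS subnSK // /K exprS.
  by rewrite -!mul_polyC !polyCM; ring.
have S2 : \sum_(j < n.+1) (c j * (j%:R * (j%:R + be))) *: (a ^+ (n - j) * b ^+ j) =
    \sum_(j < n) T j.
  rewrite big_ord_recl /= mul0r mulr0 scale0r add0r.
  by apply: eq_bigr => j _; rewrite /T KE // /bump /= add1n.
have S3 : \sum_(j < n.+1) (c j * (j%:R + be)) *: (a * a ^+ (n - j) * (b ^+ j)^`()) =
    \sum_(j < n) U j.
  rewrite big_ord_recl /= expr0 derivC mulr0 scaler0 add0r.
  apply: eq_bigr => j _; rewrite /U KE // /bump /= add1n bS.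
  by rewrite -(subnSK (ltn_ord j)) exprS -!mul_polyC !polyCM; ring.
have S4 : \sum_(j < n.+1) K j *: (a ^+ (n - j) * b ^+ j) = \sum_(j < n) U j.
  by rewrite big_ord_recr /= /K subnn mul0r mulr0 scale0r addr0.
rewrite S1 S2 S3 S4; ring.
Qed.
End JacobiAlgebra.

(** * Sturm comparison in the angle [t], where [x = cos t] *)

Section Sturm.
Variable R : realType.
Implicit Types (a b d s w t : R) (p : {poly R}).

Lemma cos_lt_mono a b : 0 <= a -> a < b -> b <= pi -> cos b < cos a.
Proof.
by move=> a0 ab bp; rewrite ltr_cos // in_itv /= ?a0 ?bp ?(le_trans (ltW ab)) ?(le_trans a0 (ltW ab)).
Qed.

Lemma sin_gt0 t : 0 < t < pi -> 0 < sin t.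
Proof. by move=> h; apply: sin_gt0_pi. Qed.

Lemma cos_lt1 t : 0 < t < pi -> -1 < cos t < 1.
Proof.
move=> /andP[t0 tp]; rewrite -{1}cospi -cos0.
by rewrite !cos_lt_mono ?lexx // ltW.
Qed.

(* With [y(t) = p(cos t)] the Jacobi equation becomes
   [y'' + 2 sigma y' + la y = 0], where
   [2 sigma t = (d + s cos t) / sin t], [d = al - be], [s = al + be + 1]; the
   weight [rho] satisfies [rho' = sigma rho], so that [rho y] has no
   first-order term, and its potential is [la - pot]. *)
Definition sigma d s t : R := (d + s * cos t) / (2 * sin t).
Definition rho d s t : R :=
  expR (d / 2 * (ln (1 - cos t) - ln (sin t)) + s / 2 * ln (sin t)).
Definition pot d s t : R :=
  ((d + s * cos t) ^+ 2 / 4 - s / 2 - d * cos t / 2) / sin t ^+ 2.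

(** [ln (1 - cos t) - ln (sin t)] is [ln (tan (t/2))], with derivative [1 / sin t]; together with
    [ln (sin t)] it integrates the two parts of [sigma]. *)
Lemma is_derive_rho d s t : 0 < t < pi ->
  is_derive t 1 (rho d s) (sigma d s t * rho d s t).
Proof.
move=> tp; have s0 := sin_gt0 tp; have /andP[_ c1] := cos_lt1 tp.
have c0 : 0 < 1 - cos t by rewrite subr_gt0.
have dlc : is_derive t 1 (fun t => ln (1 - cos t)) ((1 - cos t)^-1 * sin t).
  have h := is_derive_sub (is_derive_const 1 t) (is_derive_cos t).
  apply: (is_derive_eq (is_derive_comp h (is_derive1_ln c0))).
  by rewrite sub0r opprK.
have dls : is_derive t 1 (fun t => ln (sin t)) ((sin t)^-1 * cos t).
  exact: (is_derive_comp (is_derive_sin t) (is_derive1_ln s0)).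
have de := is_derive_add (is_derive_scale (d / 2) (is_derive_sub dlc dls))
  (is_derive_scale (s / 2) dls).
apply: (is_derive_eq (is_derive_comp de (is_derive_expR _))).
rewrite mulrC; congr (_ * _).
rewrite /sigma; have := cos2Dsin2 t; move: (sin t) (cos t) s0 c0 {dlc dls de c1} => S C s0 c0 e.
have -> : (1 - C)^-1 * S = (1 + C) / S.
  have c0' : 1 - C != 0 by rewrite gt_eqF.
  have s0' : S != 0 by rewrite gt_eqF.
  have eS : S * S = (1 - C) * (1 + C).
    have -> : S * S = (C ^+ 2 + S ^+ 2) - C ^+ 2 by ring.
    by rewrite e; ring.
  transitivity (S * S / ((1 - C) * S)); first by field; rewrite c0' s0'.
  by rewrite eS; field; rewrite c0' s0'.
by field; rewrite gt_eqF.
Qed.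

(** That is, [pot = sigma' + sigma^2], the term of order zero created by removing the first-order
    term. *)
Lemma is_derive_sigma d s t : 0 < t < pi ->
  is_derive t 1 (sigma d s) (pot d s t - sigma d s t ^+ 2).
Proof.
move=> tp; have s0 := sin_gt0 tp; have s0' : sin t != 0 by rewrite gt_eqF.
have d1 := is_derive_add (is_derive_const d t) (is_derive_scale s (is_derive_cos t)).
have s2 : 2 * sin t != 0 by rewrite mulf_neq0.
have d2 := @is_deriveV R _ t _ 1 s2 (is_derive_scale 2 (is_derive_sin t)).
apply: (is_derive_eq (is_derive_mul d1 d2)); rewrite /pot /sigma.
have e : s = s * (cos t ^+ 2 + sin t ^+ 2) by rewrite cos2Dsin2 mulr1.
rewrite (_ : s / 2 = s * (cos t ^+ 2 + sin t ^+ 2) / 2); last by rewrite -e.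
by rewrite /GRing.scale /=; field.
Qed.

(** Here [h] is the Wronskian of [u = rho y] and [v = sin (w (t - t0))] over one half-period of [v].
    If [u > 0], its derivative [(w^2 - la + pot) u v] is negative inside, although [h] goes from
    [-u w <= 0] to [u w >= 0]. *)
Lemma sturm_contra d s la w t0 p : 0 < w -> 0 < t0 -> t0 + pi / w < pi ->
  (forall t, t0 <= t <= t0 + pi / w -> w ^+ 2 < la - pot d s t) ->
  (1 - 'X ^+ 2) * p^`()^`() - (d%:P + (s + 1)%:P * 'X) * p^`() + la%:P * p = 0 ->
  (forall t, t0 <= t <= t0 + pi / w -> 0 < p.[cos t]) -> False.
Proof.
move=> w0 tgt0 tltpi hw ode hp.
have pw : 0 < pi / w :> R by rewrite divr_gt0 // pi_gt0.
have inpi t : t0 <= t <= t0 + pi / w -> 0 < t < pi.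
  by move=> /andP[h1 h2]; rewrite (lt_le_trans tgt0 h1) (le_lt_trans h2).
pose y t := p.[cos t]; pose y1 t := - sin t * p^`().[cos t].
pose v t := sin (w * (t - t0)); pose v1 t := w * cos (w * (t - t0)).
have dcomp q t : is_derive t 1 (fun t => q.[cos t]) (- sin t * q^`().[cos t]).
  by rewrite mulrC; exact: (is_derive_comp (is_derive_cos t) (is_derive_poly q _)).
have dy t : is_derive t 1 y (y1 t) by exact: dcomp.
have dy1 t : 0 < t < pi -> is_derive t 1 y1 (- 2 * sigma d s t * y1 t - la * y t).
  move=> tp; have s0 : sin t != 0 by rewrite gt_eqF // sin_gt0.
  have dns : is_derive t 1 (fun t => - sin t) (- cos t).
    by have := is_deriveN (is_derive_sin t).
  apply: (is_derive_eq (is_derive_mul dns (dcomp p^`() t))).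
  have := congr1 (fun q => q.[cos t]) ode.
  rewrite !(hornerD, hornerN, hornerM, hornerC, hornerX, hornerXn) /y1 /sigma /y.
  have := cos2Dsin2 t; move: (p^`()^`().[_]) (p^`().[_]) (p.[_]) => P2 P1' P0.
  move: (sin t) (cos t) s0 => S C s0 e1 e2.
  have -> : la * P0 = (d + (s + 1) * C) * P1' - (1 - C * C) * P2.
    by apply/eqP; rewrite -subr_eq0; apply/eqP; rewrite -e2; ring.
  have -> : 1 - C * C = S ^+ 2 by rewrite -e1; ring.
  by field.
have dlin t : is_derive t 1 (fun t => w * (t - t0)) w.
  have h := is_derive_sub (is_derive_var t) (is_derive_const t0 t).
  by apply: (is_derive_eq (is_derive_scale w h)); rewrite subr0 mulr1.
have dv t : is_derive t 1 v (v1 t).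
  by rewrite /v1 mulrC; exact: (is_derive_comp (dlin t) (is_derive_sin _)).
have dv1 t : is_derive t 1 v1 (- w ^+ 2 * v t).
  apply: (is_derive_eq (is_derive_scale w (is_derive_comp (dlin t) (is_derive_cos _)))).
  by rewrite /v; ring.
pose g t := (y1 t + sigma d s t * y t) * v t - y t * v1 t.
have dg t : 0 < t < pi ->
    is_derive t 1 g ((pot d s t - la + w ^+ 2) * y t * v t - sigma d s t * g t).
  move=> tp; have h1 := is_derive_mul (is_derive_sigma d s tp) (dy t).
  have h2 := is_derive_mul (is_derive_add (dy1 t tp) h1) (dv t).
  have h3 := is_derive_mul (dy t) (dv1 t).
  apply: (is_derive_eq (is_derive_sub h2 h3)).
  by rewrite /g /=; ring.
pose h t := rho d s t * g t.
have dh t : t0 <= t <= t0 + pi / w ->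
    is_derive t 1 h (rho d s t * ((pot d s t - la + w ^+ 2) * y t * v t)).
  move=> /inpi tp; apply: (is_derive_eq (is_derive_mul (is_derive_rho d s tp) (dg t tp))).
  by ring.
have lt0 : t0 < t0 + pi / w by rewrite ltrDl.
have [c /andP[c0 c1]] := mvt_is_derive lt0 dh.
have ce : t0 <= c <= t0 + pi / w by rewrite !ltW.
have hwe : w * (t0 + pi / w - t0) = pi.
  by rewrite addrAC subrr add0r mulrC divfK // gt_eqF.
have hend : 0 <= h (t0 + pi / w).
  rewrite /h /g /v /v1 hwe sinpi cospi.
  rewrite (_ : _ - _ = y (t0 + pi / w) * w); last by ring.
  by rewrite !mulr_ge0 ?expR_ge0 ?ltW // ?hp // lexx ltW.
have hstart : h t0 <= 0.
  rewrite /h /g /v /v1 subrr mulr0 sin0 cos0.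
  rewrite (_ : _ - _ = - (y t0 * w)); last by ring.
  rewrite mulrN oppr_le0.
  by rewrite !mulr_ge0 ?expR_ge0 ?ltW // ?hp // lexx ltW.
have vc : 0 < v c.
  apply: sin_gt0; rewrite mulr_gt0 ?subr_gt0 //=.
  by rewrite -[X in _ < X]hwe ltr_pM2l // ltrD2r.
have : rho d s c * ((pot d s c - la + w ^+ 2) * y c * v c) * (t0 + pi / w - t0) < 0.
  rewrite pmulr_llt0 ?subr_gt0 // pmulr_rlt0 ?expR_gt0 // pmulr_llt0 // pmulr_llt0 ?hp //.
  by have := hw c ce; lra.
by move=> + e; rewrite -e; lra.
Qed.

(** Without a root on the closed arc [p] keeps its sign there, and [sturm_contra] applies to [p] or
    to [-p]. *)
Lemma sturm_root d s la w t0 p : 0 < w -> 0 < t0 -> t0 + pi / w < pi ->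
  (forall t, t0 <= t <= t0 + pi / w -> w ^+ 2 < la - pot d s t) ->
  (1 - 'X ^+ 2) * p^`()^`() - (d%:P + (s + 1)%:P * 'X) * p^`() + la%:P * p = 0 ->
  exists2 x, cos (t0 + pi / w) <= x <= cos t0 & root p x.
Proof.
move=> w0 tgt0 tltpi hw ode; apply: contrapT => nroot.
have pw : 0 < pi / w :> R by rewrite divr_gt0 // pi_gt0.
have lt0 : t0 < t0 + pi / w by rewrite ltrDl.
have cin t : t0 <= t <= t0 + pi / w -> cos (t0 + pi / w) <= cos t <= cos t0.
  move=> /andP[h1 h2]; apply/andP; split.
    move: h2; rewrite le_eqVlt => /predU1P[->//|h2]; apply/ltW/cos_lt_mono => //.
      by rewrite ltW // (lt_le_trans tgt0).
    exact: ltW.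
  move: h1; rewrite le_eqVlt => /predU1P[->//|h1]; apply/ltW/cos_lt_mono => //.
    exact: ltW.
  by rewrite (le_trans h2) // ltW.
have noz x y : cos (t0 + pi / w) <= x -> x <= y -> y <= cos t0 -> p.[x] * p.[y] <= 0 -> False.
  move=> h1 h2 h3 h4; apply: nroot.
  have [z /andP[xz zy] rz] : exists2 z, x <= z <= y & root p z.
    have [px|px] := leP p.[x] 0.
      have [/eqP px0|px0] := boolP (p.[x] == 0).
        by exists x; rewrite ?lexx //; apply/rootP.
      apply: (poly_ivt h2); rewrite px /=.
      by rewrite nmulr_rle0 // lt_neqAle px0 px in h4.
    have [|z xzy] := @poly_ivt _ (- p) _ _ h2.
      by rewrite !hornerN !oppr_le0 ltW //= oppr_ge0; rewrite pmulr_rle0 in h4.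
    by rewrite rootN => rz; exists z.
  by exists z => //; rewrite (le_trans h1) //= (le_trans zy).
have sgn (e : R) : 0 < e * p.[cos t0] ->
    forall t, t0 <= t <= t0 + pi / w -> 0 < e * p.[cos t].
  move=> e0 t /cin /andP[h1 h2]; rewrite ltNge; apply/negP => e1.
  apply: (noz (cos t) (cos t0)) => //.
  have e2 : e ^+ 2 * (p.[cos t] * p.[cos t0]) <= 0.
    have -> : e ^+ 2 * (p.[cos t] * p.[cos t0]) = (e * p.[cos t]) * (e * p.[cos t0]) by ring.
    by rewrite pmulr_lle0.
  have ee : 0 < e ^+ 2.
    by rewrite exprn_even_gt0 //=; apply: contraTN e0 => /eqP ->; rewrite mul0r ltxx.
  by rewrite pmulr_rle0 in e2.
have [c0|c0|c0] := ltgtP 0 p.[cos t0].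
- apply: (sturm_contra w0 tgt0 tltpi hw ode) => t /(sgn 1).
  by rewrite !mul1r; apply.
- apply: (@sturm_contra d s la w t0 (- p)) => //.
    by rewrite !derivN; move/eqP: ode; rewrite -oppr_eq0 => /eqP <-; ring.
  move=> t /(sgn (-1)); rewrite hornerN !mulN1r; apply.
  by rewrite oppr_gt0.
- apply: (noz (cos t0) (cos t0)) => //; last by rewrite -c0 mul0r.
  by rewrite ltW // cos_lt_mono // ltW.
Qed.
End Sturm.

Section JacobiZeros.
Variable R : realType.
Implicit Types (a b d s t e : R) (p : {poly R}).

Lemma pot_bounded a b d s : 0 < a -> a <= b -> b < pi ->
  exists2 K, 0 <= K & forall t, a <= t <= b -> pot d s t <= K.
Proof.
move=> a0 ab bpi.
have [c] := @EVT_min R (@sin R) a b ab (continuous_subspaceT (@continuous_sin R)).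
rewrite in_itv /= => /andP[ac cb] cmin.
have sc : 0 < sin c by rewrite sin_gt0 // (lt_le_trans a0 ac) (le_lt_trans cb bpi).
pose M := (`|d| + `|s|) ^+ 2 / 4 + `|s| / 2 + `|d| / 2.
have M0 : 0 <= M by rewrite !addr_ge0 // ?mulr_ge0 ?invr_ge0 ?exprn_ge0 ?addr_ge0.
exists (M / sin c ^+ 2); first by rewrite divr_ge0 // exprn_ge0 // ltW.
move=> t atb; have sct : sin c <= sin t by apply: cmin; rewrite in_itv.
have st : 0 < sin t by rewrite (lt_le_trans sc).
have C1 : `|cos t| <= 1 := cos_max t.
have dC : - (d * cos t) <= `|d|.
  by rewrite (le_trans (ler_norm _)) // normrN normrM ler_piMr.
have sN : - s <= `|s| by rewrite (le_trans (ler_norm _)) // normrN.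
have dsC : (d + s * cos t) ^+ 2 <= (`|d| + `|s|) ^+ 2.
  rewrite -real_normK ?num_real // ler_pXn2r ?nnegrE ?addr_ge0 //.
  by rewrite (le_trans (ler_normD _ _)) // lerD2l normrM ler_piMr.
apply: (@le_trans _ _ (M / sin t ^+ 2)).
  by rewrite /pot ler_pM2r ?invr_gt0 ?exprn_gt0 // /M; lra.
rewrite ler_wpM2l // lef_pV2 ?posrE ?exprn_gt0 //.
by rewrite ler_pXn2r // nnegrE ltW.
Qed.

Lemma zeros_cells p (t : nat -> R) K :
  (forall k, (k < K)%N -> exists2 x, t k.+1 < x < t k & root p x) ->
  exists2 S, zeros_in p (t K) (t 0) S & size S = K.
Proof.
move=> ht; suff [S [zS sS _]] : exists S, [/\ zeros_in p (t K) (t 0) S, size S = K & t K <= t 0].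
  by exists S.
elim: K ht => [|K IH] ht; first by exists [::]; split.
have [S [/andP[uS /allP sall] sS tK]] := IH (fun k kK => ht k (leqW kK)).
have [x /andP[x1 x2] rx] := ht K (leqnn _).
exists (x :: S); split; last by rewrite ltW // (lt_trans x1) // (lt_le_trans x2).
  rewrite /zeros_in /= uS andbT x1 rx (lt_le_trans x2 tK) /=.
  apply/andP; split.
    by apply/negP => /sall /andP[/andP[h _] _]; move: (lt_trans h x2); rewrite ltxx.
  by apply/allP => z /sall /andP[/andP[h1 ->] ->]; rewrite (lt_trans x1) // (lt_trans x2).
by rewrite /= sS.
Qed.

Lemma jacobi_zeros_lower al be a b e : 0 < a -> a < b -> b < pi -> 0 < e ->
  \forall n \near \oo, exists2 S, zeros_in (jacobi al be n) (cos b) (cos a) S &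
    n%:R * ((b - a) / pi - e) <= (size S)%:R.
Proof.
move=> a0 ab bpi e0.
pose d := al - be; pose s := al + be + 1.
have [K K0 hK] := pot_bounded d s a0 (ltW ab) bpi.
(* With [w = n - c] the eigenvalue [n (n + s)] exceeds [w^2] by [n (s + 2c) - c^2 >= n - c^2]; the
   condition [n2] makes this larger than the bound [K] of the potential. *)
pose c := `|s| + 1.
have pi0 : 0 < pi :> R := pi_gt0 R.
near=> n.
have n1 : c + 2 <= n%:R by near: n; exact: nbhs_infty_ger.
have n2 : c ^+ 2 + K + 1 <= n%:R by near: n; exact: nbhs_infty_ger.
(* Pays for the cell lost by rounding and for [n - c - 1] in place of [n]. *)
have n3 : (((c + 1) * (b - a)) / pi + 1) / e <= n%:R by near: n; exact: nbhs_infty_ger.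
have c1 : 1 <= c by rewrite lerDr.
(* The cell length [l] is slightly more than the half-period [pi / w]: the closed arc given to
   [sturm_root] is centred in its cell with margin [h], so roots of different cells are distinct. *)
pose w := n%:R - c; pose l := pi / (w - 1).
have w1 : 1 < w - 1 + 1 - 0 by rewrite /w; lra.
have w0 : 0 < w - 1 by rewrite /w; lra.
have l0 : 0 < l by rewrite divr_gt0.
have wl : pi / w < l by rewrite ltr_pM2l // ltf_pV2 ?posrE; lra.
pose N := Num.truncn ((b - a) / l).
have /truncn_itv/andP[N1 N2] : 0 <= (b - a) / l by rewrite divr_ge0 ?subr_ge0 // ltW.
rewrite -/N in N1 N2.
have Nl : N%:R * l <= b - a by rewrite -ler_pdivlMr.
pose t k := cos (a + k%:R * l).
have abk k : (k <= N)%N -> a + k%:R * l <= b.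
  by move=> kN; rewrite -lerBrDl (le_trans _ Nl) // ler_pM2r // ler_nat.
have [|S zS sS] := @zeros_cells (jacobi al be n) t N.
  move=> k kN; pose h := (l - pi / w) / 2.
  have h0 : 0 < h by rewrite divr_gt0 // subr_gt0.
  have kl0 : 0 <= k%:R * l by rewrite mulr_ge0 // ltW.
  pose t0 := a + k%:R * l + h.
  have t1E : a + k.+1%:R * l = t0 + pi / w + h by rewrite /t0 /h -natr1; field; rewrite /w; lra.
  have t1b : t0 + pi / w + h <= b by rewrite -t1E; exact: abk.
  have t0a : a + k%:R * l < t0 by rewrite ltrDl.
  have pw : 0 < pi / w by rewrite divr_gt0 //; lra.
  have [|||||x /andP[x1 x2] rx] := @sturm_root R d s (n%:R * (n%:R + al + be + 1)) w t0 (jacobi al be n).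
  - by lra.
  - by lra.
  - by lra.
  - move=> u /andP[u1 u2]; have : pot d s u <= K by apply: hK; lra.
    have -> : n%:R * (n%:R + al + be + 1) = n%:R * (n%:R + s) by rewrite /s; ring.
    have sc : - s <= c - 1 by rewrite /c addrK (le_trans (ler_norm _)) // normrN.
    have : n%:R <= n%:R * (s + 2 * c) by rewrite ler_peMr //; lra.
    by rewrite /w; nra.
  - have := jacobi_ode al be n; rewrite /d /s => <-; congr (_ + _ + _).
    rewrite -mulNr; congr (_ * _).
    have -> : al + be + 1 + 1 = al + be + 2 by ring.
    by rewrite !polyCB; ring.
  exists x => //; apply/andP; split.
    rewrite /t t1E (lt_le_trans _ x1) // cos_lt_mono //; lra.
  rewrite /t (le_lt_trans x2) // cos_lt_mono //; lra.
exists S.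
  case/andP: zS => uS /allP aS; rewrite /zeros_in uS; apply/allP => x /aS.
  rewrite /t mul0r addr0 => /andP[/andP[x1 ->] ->]; rewrite !andbT.
  rewrite (le_lt_trans _ x1) //.
  have := abk N (leqnn _); rewrite le_eqVlt => /predU1P[->//|h].
  rewrite ltW // cos_lt_mono // ?ltW //.
  by rewrite ltr_wpDr // mulr_ge0 // ltW.
rewrite sS.
have N3 : (b - a) / l = (b - a) / pi * n%:R - (c + 1) * (b - a) / pi.
  rewrite /l invf_div /w; have : (pi : R) != 0 by rewrite gt_eqF.
  by move: (pi : R) => P P0; field.
rewrite ler_pdivrMr // in n3.
rewrite -natr1 in N2.
by rewrite N3 in N2; nra.
Unshelve. all: by end_near. Qed.
End JacobiZeros.

(** * The arcsine limit *)

Section ArcsineIntegral.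
Variable R : realType.
Notation mu := (@lebesgue_measure R).

Definition arcsine_weight (x : R) : R := (Num.sqrt (1 - x ^+ 2))^-1.

Lemma arcsine_weight_ge0 x : 0 <= arcsine_weight x.
Proof. by rewrite invr_ge0 sqrtr_ge0. Qed.

Lemma one_sub_sqr_gt0 (x : R) : -1 < x < 1 -> 0 < 1 - x ^+ 2.
Proof. by move=> /andP[x1 x2]; rewrite subr_gt0 expr2; nra. Qed.

Lemma continuous_arcsine_weight x : -1 < x < 1 ->
  {for x, continuous arcsine_weight}.
Proof.
move=> /one_sub_sqr_gt0 hx.
apply: cvgV; first by rewrite gt_eqF // sqrtr_gt0.
apply: (@continuous_comp _ _ _ (fun x : R => 1 - x ^+ 2) Num.sqrt); last exact: sqrt_continuous.
apply: cvgB; first exact: cvg_cst.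
exact: exprn_continuous.
Qed.

Lemma integral_arcsine_weight_le (c : R) : 0 < c < 1 ->
  (\int[mu]_(x in `[(- c)%R, c]) (arcsine_weight x)%:E <= pi%:E)%E.
Proof.
move=> /andP[c0 c1].
have inI x : - c <= x <= c -> -1 < x < 1 by move=> /andP[h1 h2]; lra.
have dA x : - c <= x <= c -> is_derive x 1 (@asin R) (arcsine_weight x).
  by move=> /inI; exact: is_derive1_asin.
have cA : {within `[- c, c], continuous (@asin R)} := is_derive_within_continuous dA.
have cc : - c < c by lra.
rewrite (@continuous_FTC2 _ _ (@asin R)) //.
- rewrite -EFinB lee_fin.
  have := @asin_lepi2 R c; have := @asin_geNpi2 R (- c).
  have h : -1 <= - c <= 1 by lra.
  have h' : -1 <= c <= 1 by lra.
  by move=> /(_ h) h1 /(_ h') h2; lra.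
- apply: continuous_in_subspaceT => x; rewrite inE /= in_itv /= => /inI.
  exact: continuous_arcsine_weight.
- have [_ cr cl] := (continuous_within_itvP _ cc).1 cA; split => // x.
  by rewrite in_itv /= => /andP[h1 h2]; have [] := dA x _; rewrite ?ltW.
- move=> x; rewrite in_itv /= => /andP[h1 h2].
  have := dA x; rewrite !ltW // => /(_ isT) [_ <-].
  by rewrite derive1E.
Qed.

(** Monotone exhaustion by [[-c i, c i]], where [asin] is a primitive and its range bounds every
    integral by [pi]. *)
Lemma integrable_arcsine_weight :
  mu.-integrable `[(-1 : R), 1] (EFin \o arcsine_weight).
Proof.
have mo : measurable_fun `](-1 : R), 1[ arcsine_weight.
  apply: open_continuous_measurable_fun; first exact: interval_open.
  by move=> x; rewrite inE /= in_itv /=; exact: continuous_arcsine_weight.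
have moE : measurable_fun `](-1 : R), 1[ (EFin \o arcsine_weight).
  exact/measurable_EFinP.
apply/integrableP; split.
  apply/measurable_EFinP/measurable_fun_itv_bndo_bndcP.
  exact/measurable_fun_itv_obnd_cbndP.
under eq_integral => x _ do rewrite /= ger0_norm ?arcsine_weight_ge0 //.
rewrite integral_itv_bndoo //.
(* The shift by 2 keeps [c 0] positive. *)
pose c (i : nat) : R := 1 - i.+2%:R^-1.
have c01 i : 0 < c i < 1.
  rewrite /c ltrBlDr ltrDl invr_gt0 ltr0n andbT subr_gt0.
  by rewrite invf_lt1 ?ltr1n // ltr0n.
pose F i := `[- c i, c i]%classic.
have UF : \bigcup_i F i = `](-1 : R), 1[%classic.
  apply/seteqP; split => x /=.
    move=> [i _]; rewrite /F /= !in_itv /=; have := c01 i; lra.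
  rewrite in_itv /= => /andP[x1 x2].
  have d0 : 0 < 1 - `|x| by rewrite subr_gt0 ltr_norml x1.
  exists (Num.truncn (1 - `|x|)^-1) => //.
  set i := Num.truncn _; have ti : (1 - `|x|)^-1 < i.+1%:R := truncnS_gt _.
  have hi : i.+2%:R^-1 < 1 - `|x|.
    by rewrite invf_plt ?posrE ?ltr0n // (lt_trans ti) // ltr_nat.
  have : - c i <= x <= c i by rewrite -ler_norml /c lerBrDr -lerBrDl ltW.
  by rewrite /F /= in_itv.
have ndF : nondecreasing_seq F.
  move=> i j ij; rewrite subsetEset => x; rewrite /F /= !in_itv /=.
  have : c i <= c j.
    by rewrite /c lerD2l lerN2 lef_pV2 ?posrE ?ltr0n // ler_nat !ltnS.
  by move=> h /andP[h1 h2]; rewrite (le_trans _ h1) ?lerN2 //= (le_trans h2).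
have cvF : (\int[mu]_(x in F i) (arcsine_weight x)%:E @[i --> \oo] -->
    \int[mu]_(x in \bigcup_i F i) (arcsine_weight x)%:E)%E.
  apply: ge0_nondecreasing_set_cvg_integral => //.
  - by move=> i; exact: measurable_itv.
  - move=> i; apply: measurable_funS moE; first exact: measurable_itv.
    by rewrite -UF; exact: bigcup_sup.
  - by move=> i x _; rewrite lee_fin arcsine_weight_ge0.
rewrite UF in cvF.
have lim1 : (\int[mu]_(x in `](-1)%R, 1%R[) (arcsine_weight x)%:E <= pi%:E)%E.
  rewrite -(cvg_lim _ cvF) //; apply: lime_le.
    by apply/cvg_ex; eexists; exact: cvF.
  by apply: nearW => i; exact: integral_arcsine_weight_le.
by rewrite (le_lt_trans lim1) // ltry.
Qed.

(* At the end points the integrand has the junk value [0]. *)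
Lemma arcsine_primitive (f : R -> R) (M : R) :
  (forall x : R, -1 < x < 1 -> {for x, continuous f}) ->
  (forall x : R, -1 < x < 1 -> `|f x| <= M) ->
  exists F : R -> R,
    [/\ forall x : R, -1 < x < 1 -> is_derive x 1 F (f x * arcsine_weight x),
        {within `[(-1 : R), 1], continuous F}, F (-1) = 0 &
        F 1 = \int[mu]_(x in `](-1 : R), 1[) (f x / Num.sqrt (1 - x ^+ 2))].
Proof.
move=> fc fM; pose W x := f x * arcsine_weight x.
have Wc (x : R) : -1 < x < 1 -> {for x, continuous W}.
  by move=> hx; apply: cvgM; [exact: fc | exact: continuous_arcsine_weight].
have W1 : W 1 = 0 by rewrite /W /arcsine_weight expr1n subrr sqrtr0 invr0 mulr0.
have WN1 : W (-1) = 0.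
  by rewrite /W /arcsine_weight sqrrN expr1n subrr sqrtr0 invr0 mulr0.
have mW : measurable_fun `](-1 : R), 1[ W.
  apply: open_continuous_measurable_fun; first exact: interval_open.
  by move=> x; rewrite inE /= in_itv /=; exact: Wc.
have mWc : measurable_fun `[(-1 : R), 1] W.
  apply/measurable_fun_itv_bndo_bndcP.
  exact/measurable_fun_itv_obnd_cbndP.
have iW : mu.-integrable `[(-1 : R), 1] (EFin \o W).
  apply: (@le_integrable _ _ _ mu _ _ _ (fun x => (M%:E * (arcsine_weight x)%:E)%E)) => //.
  - exact/measurable_EFinP.
  - move=> x; rewrite /= in_itv /= => /andP[x1 x2].
    rewrite lee_fin.
    have [->|xn1] := eqVneq x 1; first by rewrite W1 normr0.
    have [->|xnN1] := eqVneq x (-1); first by rewrite WN1 normr0.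
    have hx : -1 < x < 1 by rewrite !lt_neqAle x1 x2 xn1 eq_sym xnN1.
    by rewrite /W !normrM ler_wpM2r // (le_trans (fM x hx)) // ler_norm.
  - exact: (integrableZl _ M integrable_arcsine_weight).
exists (fun x : R => \int[mu]_(t in `[(-1 : R), x]) W t); split.
- move=> x hx; have /andP[x1 x2] := hx.
  have [dF F'] := @continuous_FTC1_closed R W (-1) x 1 x2 iW x1 (Wc x hx).
  by rewrite -/(W x) -F' derive1E; exact: DeriveDef.
- exact: (@parameterized_integral_continuous R (-1) 1 W _ iW).
- by rewrite set_itv1 Rintegral_set1.
- rewrite -Rintegral_itv_bndo_bndc; last first.
    by apply: integrableS iW => //; apply: subset_itvl; rewrite bnd_simp.
  rewrite -Rintegral_itv_obnd_cbnd //.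
  by apply: integrableS iW => //; apply: subset_itv_oo_cc.
Qed.
End ArcsineIntegral.

(** * From counts on arcs to means of continuous functions *)

Section ArcsineLimit.
Variable R : realType.
Implicit Types (a b e x t : R).

(** Compactness in the form of a supremum argument: the local property at the supremum of the right
    ends reached from [a] carries beyond it unless it is [b]. It replaces a uniform partition. *)
Lemma interval_induction (Q : R -> R -> Prop) a b : a < b ->
  (forall u v w, Q u v -> Q v w -> Q u w) ->
  (forall x, a <= x <= b -> exists2 d, 0 < d & forall u v, a <= u -> x - d < u ->
     u < v -> v < x + d -> v <= b -> Q u v) ->
  Q a b.
Proof.
move=> ab Qtrans Qloc.
pose A := [set x | a < x <= b /\ Q a x].
have [d0 d0gt Q0] := Qloc a (ltac:(by rewrite lexx ltW)).
pose x0 := Num.min b (a + d0 / 2).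
have ax0 : a < x0 by rewrite /x0 lt_min ab ltrDl divr_gt0.
have Ax0 : A x0.
  have x0b : x0 <= b by rewrite /x0 ge_min lexx.
  split; first by rewrite ax0.
  apply: Q0 => //; first by rewrite ltrBlDr ltrDl.
  by rewrite /x0 gt_min ltrD2l ltr_pdivrMr // mulr_natr mulr2n ltrDl d0gt orbT.
have hA : has_sup A.
  by split; [exists x0 | exists b => x [/andP[]]].
have sb : sup A <= b by apply: ge_sup; [exists x0 | move=> x [/andP[]]].
have as_ : a < sup A by apply: (lt_le_trans ax0); apply: ub_le_sup => //; case: hA.
have [d d0' Qs] := Qloc (sup A) (ltac:(by rewrite sb ltW)).
have [x [axb Qax] xs] := sup_adherent d0' hA.
have xle : x <= sup A by apply: ub_le_sup => //; case: hA.
case/andP: axb => ax xb.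
pose v := Num.min b (sup A + d / 2).
have vb : v <= b by rewrite /v ge_min lexx.
have vd : v < sup A + d.
  by rewrite /v gt_min ltrD2l ltr_pdivrMr // mulr_natr mulr2n ltrDl d0' orbT.
have Qav : Q a v.
  have [xv|vx] := ltP x v.
    by apply: (Qtrans _ _ _ Qax); apply: Qs => //; exact: ltW.
  suff -> : v = x by [].
  apply/eqP; rewrite eq_le vx /= /v le_min xb /=.
  by rewrite (le_trans xle) // lerDl divr_ge0 // ltW.
have Av : A v.
  split=> //; rewrite vb andbT /v lt_min ab /= (lt_trans as_) //.
  by rewrite ltrDl divr_gt0.
have vs : v <= sup A by apply: ub_le_sup => //; case: hA.
move: vs; rewrite {1}/v ge_min => /orP[bs|]; last first.
  by rewrite gerDl leNgt divr_gt0.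
suff <- : v = b by [].
apply/eqP; rewrite eq_le vb /v le_min lexx /=.
by rewrite (le_trans bs) // lerDl divr_ge0 // ltW.
Qed.

(** Stands for the lists of zeros, of which only the location, the counts on arcs and the size are
    used. The cells are half-open so that adjacent ones are disjoint. *)
Variable Z : nat -> seq R.
Hypothesis Zin : forall n x, x \in Z n -> -1 < x < 1.
Hypothesis Zcount : forall a b e, 0 < a -> a < b -> b < pi -> 0 < e ->
  \forall n \near \oo, n%:R * ((b - a) / pi - e) <=
     (count (fun x => cos b < x <= cos a)%R (Z n))%:R.

Lemma sum_cells_lower (g Phi : R -> R) a b e : 0 < e -> 0 < a -> a < b -> b < pi ->
  (forall x, -1 < x < 1 -> 0 <= g x) ->
  (forall x, -1 < x < 1 -> {for x, continuous g}) ->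
  (forall t, a <= t <= b -> is_derive t 1 Phi (g (cos t))) ->
  \forall n \near \oo, n%:R * ((Phi b - Phi a) / pi - e * (b - a)) <=
    \sum_(x <- Z n | cos b < x <= cos a) g x.
Proof.
move=> e0 a0 ab bpi g0 gc dPhi.
(* The error [e * (v - u)] is additive in the arc, so the estimates on adjacent arcs add up to one
   of the same form. *)
pose Q u v := a <= u /\ u < v /\ v <= b /\
  \forall n \near \oo, n%:R * ((Phi v - Phi u) / pi - e * (v - u)) <=
    \sum_(x <- Z n | cos v < x <= cos u) g x.
have pi1 : 1 <= pi :> R by have := pi_ge2 R; lra.
have pi0 : 0 < pi :> R := pi_gt0 R.
suff : Q a b by case=> _ [_ [_ ]].
have cm u v : a <= u -> u <= v -> v <= b -> cos v <= cos u.
  move=> h1; rewrite le_eqVlt => /predU1P[->//|h2] h3; apply/ltW/cos_lt_mono => //.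
    by rewrite (le_trans _ h1) // ltW.
  by rewrite (le_trans h3) // ltW.
apply: interval_induction => //.
  move=> u v w [au [uv [vb Q1]]] [_ [vw [wb Q2]]].
  do 3!(split; [by [] || exact: lt_trans vw |]).
  near=> n.
  have h1 : n%:R * ((Phi v - Phi u) / pi - e * (v - u)) <=
    \sum_(x <- Z n | cos v < x <= cos u) g x by near: n.
  have h2 : n%:R * ((Phi w - Phi v) / pi - e * (w - v)) <=
    \sum_(x <- Z n | cos w < x <= cos v) g x by near: n.
  have -> : \sum_(x <- Z n | cos w < x <= cos u) g x =
    \sum_(x <- Z n | cos w < x <= cos v) g x + \sum_(x <- Z n | cos v < x <= cos u) g x.
    rewrite (bigID (fun x => x <= cos v)%R) /=; congr (_ + _); apply: eq_bigl => x.
      have [xv|] := leP x (cos v); rewrite ?andbF //= !andbT.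
      by rewrite (le_trans xv) ?andbT // cm // ltW.
    rewrite -ltNge; have [vx|] := ltP (cos v) x; rewrite ?andbF ?andbT //=.
    by rewrite (le_lt_trans _ vx) // cm // ?(le_trans au) // ltW.
  apply: le_trans (lerD h2 h1); rewrite -mulrDr.
  by rewrite ler_wpM2l //; lra.
move=> x axb.
pose eta := e / 4.
have eta0 : 0 < eta by rewrite divr_gt0.
have xin : 0 < x < pi by case/andP: axb => h1 h2; rewrite (lt_le_trans a0) //= (le_lt_trans h2).
have Gc : {for x, continuous (fun t => g (cos t))}.
  apply: continuous_comp; first exact: continuous_cos.
  by apply: gc; exact: cos_lt1.
have := Gc; move=> /cvgrPdist_lt/(_ eta eta0).
rewrite -nbhs_nearE => /nbhs_ballP[d /= d0 hd].
exists d => // u v au xu uv vx vb; split => //; split => //; split => //.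
have ball t : u <= t <= v -> `|g (cos x) - g (cos t)| < eta.
  move=> /andP[h1 h2]; apply: hd; rewrite /ball /= ltr_norml; lra.
have [c /andP[uc cv]] := mvt_is_derive uv (fun t (h : u <= t <= v) =>
  dPhi t (ltac:(case/andP: h => h1 h2; rewrite (le_trans au) //= (le_trans h2) //))).
move=> PhiE.
have xc := ball c (ltac:(by rewrite !ltW)).
(* A constant lower bound of [g] on the cell; it must be nonnegative to multiply the counting
   inequality. *)
pose m := Num.max 0 (g (cos x) - eta).
have m0 : 0 <= m by rewrite le_max lexx.
have m1 : g (cos x) - eta <= m by rewrite le_max lexx orbT.
(* Chosen so that [m * e' <= eta * (v - u)]; dividing by [m + 1] avoids the case [m = 0]. *)
pose e' := eta * (v - u) / (m + 1).
have e'0 : 0 < e' by rewrite divr_gt0 ?mulr_gt0 ?subr_gt0 // ltr_wpDl.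
have me' : m * e' <= eta * (v - u).
  rewrite /e' mulrA ler_pdivrMr ?ltr_wpDl // mulrC.
  by rewrite ler_wpM2l ?lerDl ?ler01 ?mulr_ge0 ?subr_ge0 ?ltW .
have u0 : 0 < u by exact: lt_le_trans au.
have vpi : v < pi by exact: le_lt_trans bpi.
near=> n.
have hc : n%:R * ((v - u) / pi - e') <=
     (count (fun x => cos v < x <= cos u)%R (Z n))%:R by near: n; exact: Zcount.
apply: (@le_trans _ _ (m * (count (fun x => cos v < x <= cos u)%R (Z n))%:R)).
  apply: (@le_trans _ _ (m * (n%:R * ((v - u) / pi - e')))); last exact: ler_wpM2l.
  rewrite mulrCA ler_wpM2l // PhiE.
  have gcm : g (cos c) <= m + 2 * eta by move: xc; rewrite ltr_norml; lra.
  have q0 : g (cos c) * (v - u) / pi <= (m + 2 * eta) * (v - u) / pi.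
    by rewrite ler_pM2r ?invr_gt0 // ler_pM2r ?subr_gt0.
  have q1 : 2 * eta * (v - u) / pi <= 2 * eta * (v - u).
    by rewrite ler_pdivrMr // ler_peMr // !mulr_ge0 ?subr_ge0 ?ltW.
  have -> : e = 4 * eta by rewrite /eta mulrC divfK.
  have q2 : 0 <= eta * (v - u) by rewrite mulr_ge0 ?subr_ge0 ?ltW.
  have -> : m * ((v - u) / pi - e') = m * (v - u) / pi - m * e' by ring.
  have q3 : (m + 2 * eta) * (v - u) / pi = m * (v - u) / pi + 2 * eta * (v - u) / pi.
    by rewrite -mulrDl -mulrDl.
  lra.
rewrite -sum1_count natr_sum mulr_sumr mulr1 big_seq_cond [leRHS]big_seq_cond.
apply: ler_sum => y /andP[/Zin yin /andP[vy yu]].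
rewrite ge_max g0 //=.
have yI : y \in `[-1, 1] by case/andP: yin => h1 h2; rewrite in_itv /= !ltW.
have ay : 0 <= acos y <= pi by rewrite acos_ge0 ?acos_lepi // -[_ <= _ <= _]in_itv.
have ayI : acos y \in `[0, pi] by rewrite in_itv.
have ac := acosK yI.
have b1 : u <= acos y <= v.
  have uI : u \in `[0, pi] by rewrite in_itv /= !ltW // (lt_trans uv).
  have vI : v \in `[0, pi] by rewrite in_itv /= !ltW // (lt_trans u0).
  by rewrite !leNgt -ltr_cos // -[v < _]ltr_cos // ac -!leNgt yu ltW.
have := ball _ b1; rewrite ac ltr_norml; lra.
Unshelve. all: by end_near. Qed.

Lemma size_pos_near : \forall n \near \oo, (0 < size (Z n))%N.
Proof.
have pi0 : 0 < pi :> R := pi_gt0 R.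
near=> n.
have h : n%:R * ((pi / 2 - pi / 4) / pi - 8^-1) <=
     (count (fun x => cos (pi / 2) < x <= cos (pi / 4))%R (Z n))%:R :> R.
  near: n; apply: Zcount; lra.
have n1 : 1 <= n%:R :> R by near: n; exact: nbhs_infty_ger.
have c1 : (pi / 2 - pi / 4) / pi - 8^-1 = 8^-1 :> R.
  have : (pi : R) != 0 by rewrite gt_eqF.
  by move: (pi : R) => P P0; field.
rewrite c1 in h; apply: leq_trans (count_size (fun x => cos (pi / 2) < x <= cos (pi / 4))%R (Z n)).
by rewrite -(ltr_nat R) (lt_le_trans _ h) // divr_gt0 //; lra.
Unshelve. all: by end_near. Qed.

Variable C : R.
Hypothesis C0 : 0 <= C.
Hypothesis Zsize : \forall n \near \oo, (size (Z n))%:R <= n%:R + C.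

Definition mean (f : R -> R) n := (size (Z n))%:R^-1 * \sum_(x <- Z n) f x.

Lemma mean_lower (f Phi : R -> R) M e : 0 < e ->
  (forall x, -1 < x < 1 -> {for x, continuous f}) ->
  (forall x, -1 < x < 1 -> `|f x| <= M) ->
  (forall t, 0 < t < pi -> is_derive t 1 Phi (f (cos t))) ->
  {for 0, continuous Phi} -> {for pi, continuous Phi} ->
  \forall n \near \oo, (Phi pi - Phi 0) / pi - e <= mean f n.
Proof.
move=> e0 fc fM dPhi Phi0 Phipi.
have pi0 : 0 < pi :> R := pi_gt0 R.
have pi1 : 1 <= pi :> R by have := pi_ge2 R; lra.
have M0 : 0 <= M by apply: le_trans (fM 0 _); rewrite // oppr_lt0 ltr01.
(* Cutting off both ends costs at most [d] in the increment of [Phi] and [M * d] in that of [M * t],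
   together [e / 4]. *)
pose d := e / (4 * (1 + M)).
have d0 : 0 < d by rewrite divr_gt0 // mulr_gt0 // ltr_wpDr.
have dM : d * (1 + M) = e / 4 by rewrite /d; field; lra.
have d20 : 0 < d / 2 by rewrite divr_gt0.
have loc c : {for c, continuous Phi} -> exists2 r, 0 < r &
    forall t, `|c - t| < r -> `|Phi c - Phi t| < d / 2.
  move=> /cvgrPdist_lt/(_ _ d20); rewrite -nbhs_nearE => /nbhs_ballP[r /= r0 hr].
  by exists r => // t h; apply: hr.
have [r1 r10 h1] := loc _ Phi0; have [r2 r20 h2] := loc _ Phipi.
pose a := Num.min (Num.min r1 d) pi / 4.
pose b := pi - Num.min (Num.min r2 d) pi / 4.
have a0 : 0 < a by rewrite divr_gt0 // !lt_min r10 d0 pi0.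
have b0 : 0 < pi - b by rewrite opprB addrC subrK divr_gt0 // !lt_min r20 d0 pi0.
have [ar1 ad api] : [/\ a <= r1 / 4, a <= d / 4 & a <= pi / 4].
  by rewrite /a !ler_pM2r ?invr_gt0 // !ge_min !lexx !orbT.
have [br1 bd bpi] : [/\ pi - b <= r2 / 4, pi - b <= d / 4 & pi - b <= pi / 4].
  by rewrite opprB addrC subrK !ler_pM2r ?invr_gt0 // !ge_min !lexx !orbT.
have Pa : `|Phi 0 - Phi a| < d / 2 by apply: h1; rewrite sub0r normrN gtr0_norm //; lra.
have Pb : `|Phi pi - Phi b| < d / 2 by apply: h2; rewrite gtr0_norm //; lra.
rewrite !ltr_norml in Pa Pb.
pose g x := f x + M; pose Phig t := Phi t + M * t.
have g0 x : -1 < x < 1 -> 0 <= g x.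
  by move=> /fM; rewrite ler_norml /g; lra.
have gc x : -1 < x < 1 -> {for x, continuous g}.
  by move=> /fc fx; apply: cvgD; [exact: fx | exact: cvg_cst].
have dPhig t : a <= t <= b -> is_derive t 1 Phig (g (cos t)).
  move=> /andP[t1 t2]; have tp : 0 < t < pi by apply/andP; split; lra.
  apply: (is_derive_eq (is_derive_add (dPhi t tp) (is_derive_scale M (is_derive_var t)))).
  by rewrite mulr1.
pose eta := e / 4 / pi.
have eta0 : 0 < eta by rewrite !divr_gt0.
have ab : a < b by lra.
have bp : b < pi by lra.
pose X := (Phig b - Phig a) / pi - eta * (b - a).
have XE : (Phi pi - Phi 0) / pi + M - e / 2 <= X.
  have x1 : eta * (b - a) <= e / 4.
    apply: (@le_trans _ _ (eta * pi)); first by rewrite ler_pM2l //; lra.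
    by rewrite /eta divfK // gt_eqF.
  have x2 : (Phi pi - Phi 0) / pi + M - e / 4 <= (Phig b - Phig a) / pi.
    rewrite ler_pdivlMr // mulrBl mulrDl divfK ?gt_eqF //.
    have : d * (1 + M) <= e / 4 * pi by rewrite dM ler_peMr // divr_ge0 // ltW.
    have : M * (pi - d) <= M * (b - a) by rewrite ler_wpM2l //; lra.
    rewrite /Phig; lra.
  rewrite /X; lra.
near=> n.
have S1 : n%:R * X <= \sum_(x <- Z n | cos b < x <= cos a) g x.
  by near: n; exact: sum_cells_lower.
have N0 : (0 < size (Z n))%N by near: n; exact: size_pos_near.
have N1 : (size (Z n))%:R <= n%:R + C by near: n; exact: Zsize.
have n1 : X * C / (e / 2) <= n%:R by near: n; exact: nbhs_infty_ger.
have NR : 0 < (size (Z n))%:R :> R by rewrite ltr0n.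
have S2 : \sum_(x <- Z n | cos b < x <= cos a) g x <= \sum_(x <- Z n) g x.
  rewrite [leRHS](bigID (fun x => cos b < x <= cos a)) /= lerDl.
  by rewrite big_seq_cond sumr_ge0 // => x /andP[/Zin /g0].
have S3 : 0 <= \sum_(x <- Z n) g x.
  by rewrite big_seq_cond sumr_ge0 // => x /andP[/Zin /g0].
have S4 : \sum_(x <- Z n) g x = \sum_(x <- Z n) f x + M * (size (Z n))%:R.
  rewrite big_split /=; congr (_ + _).
  by rewrite big_const_seq count_predT iter_addr_0 mulr_natr.
have : X - e / 2 <= (size (Z n))%:R^-1 * \sum_(x <- Z n) g x.
  rewrite [leRHS]mulrC ler_pdivlMr //.
  (* Replacing the size by its upper bound [n + C] preserves the inequality only when the factor is
     positive; otherwise nonnegativity of the sum suffices. *)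
  have [Xe|Xe] := leP (X - e / 2) 0.
    by apply: le_trans S3; rewrite pmulr_lle0.
  apply: le_trans (le_trans S1 S2).
  apply: (@le_trans _ _ ((X - e / 2) * (n%:R + C))); first by rewrite ler_pM2l.
  rewrite ler_pdivrMr ?divr_gt0 // in n1.
  have : 0 <= e / 2 * C by rewrite mulr_ge0 // divr_ge0 // ltW.
  by move: (X) n1 => Y n1 h; lra.
rewrite S4 mulrDr mulrCA mulVf ?gt_eqF // mulr1 -/(mean f n).
lra.
Unshelve. all: by end_near. Qed.

(** With [H = F (cos t)] the weight cancels the factor [sin t], so [-H] is a primitive of
    [f (cos t)]. The lower bounds for [f] and for [-f] have opposite main terms and enclose the
    mean. *)
Lemma mean_arcsine_limit (f : R -> R) (M : R) :
  (forall x, -1 < x < 1 -> {for x, continuous f}) ->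
  (forall x, -1 < x < 1 -> `|f x| <= M) ->
  mean f n @[n --> \oo] -->
  pi^-1 * \int[lebesgue_measure]_(x in `](-1 : R), 1[) (f x / Num.sqrt (1 - x ^+ 2)).
Proof.
move=> fc fM; have [F [dF Fc FN1 F1]] := arcsine_primitive fc fM.
rewrite -F1.
pose H t := F (cos t).
(* At the end points [F] is continuous only from inside [[-1, 1]]; this is enough since [cos] stays
   there. *)
have Hc t : {for t, continuous H}.
  have cI : cos t \in `[(-1 : R), 1] by rewrite in_itv /= cos_geN1 cos_le1.
  have Fct := (subspace_continuousP _ F).1 Fc (cos t) cI.
  apply/cvgrPdist_lt => e e0; move/cvgrPdist_lt/(_ e e0): Fct => Fct.
  have h : \forall u \near t, cos u \in `[(-1 : R), 1] -> `|F (cos t) - F (cos u)| < e.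
    exact: (@continuous_cos R t _ Fct).
  near=> u; have hu : cos u \in `[(-1 : R), 1] -> `|F (cos t) - F (cos u)| < e by near: u.
  by apply: hu; rewrite in_itv /= cos_geN1 cos_le1.
have dH t : 0 < t < pi -> is_derive t 1 H (- f (cos t)).
  move=> tp; have cI := cos_lt1 tp; have s0 := sin_gt0 tp.
  apply: (is_derive_eq (is_derive_comp (is_derive_cos t) (dF _ cI))).
  rewrite /arcsine_weight -sin2cos2 sqrtr_sqr gtr0_norm //.
  by field; rewrite gt_eqF.
have H0 : H 0 = F 1 by rewrite /H cos0.
have Hpi : H pi = 0 by rewrite /H cospi.
apply/cvgrPdist_le => e e0.
have L1 : \forall n \near \oo, (- H pi - (- H 0)) / pi - e <= mean f n.
  apply: (@mean_lower f (fun t => - H t) M e e0 fc fM).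
  - move=> t /dH; move/(is_derive_scale (-1)); rewrite mulN1r opprK.
    by under [X in is_derive _ _ X]eq_fun do rewrite mulN1r.
  - by apply: cvgN; exact: Hc.
  - by apply: cvgN; exact: Hc.
have L2 : \forall n \near \oo, (H pi - H 0) / pi - e <= mean (fun x => - f x) n.
  apply: (@mean_lower (fun x => - f x) H M e e0) => //.
  - by move=> x hx; apply: cvgN; exact: fc.
  - by move=> x hx; rewrite normrN fM.
near=> n.
have l1 : (- H pi - (- H 0)) / pi - e <= mean f n by near: n.
have l2 : (H pi - H 0) / pi - e <= mean (fun x => - f x) n by near: n.
have mN : mean (fun x => - f x) n = - mean f n by rewrite /mean sumrN mulrN.
rewrite mN in l2; rewrite Hpi H0 in l1 l2.
rewrite ler_norml; apply/andP; split; lra.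
Unshelve. all: by end_near. Qed.
End ArcsineLimit.

(** * Exceptional Jacobi polynomials *)

Section InnerZeros.
Variable R : realType.
Implicit Types (p q : {poly R}) (x : R).

Lemma sum_mup_lt_size p (s : seq R) : p != 0 -> uniq s ->
  (\sum_(x <- s) mup x p < size p)%N.
Proof.
elim: s p => [|x s IH] p p0 /=; first by rewrite big_nil size_poly_gt0.
move=> /andP[xs us]; rewrite big_cons.
have /dvdpP[q qE] : ('X - x%:P) ^+ mup x p %| p by rewrite -mup_geq.
have q0 : q != 0 by apply: contraNneq p0 => q0; rewrite qE q0 mul0r.
have -> : (\sum_(y <- s) mup y p = \sum_(y <- s) mup y q)%N.
  rewrite big_seq [RHS]big_seq; apply: eq_bigr => y ys; rewrite {1}qE mupMl //.
  rewrite rootE horner_exp hornerXsubC expf_eq0 subr_eq0 negb_and.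
  by apply/orP; right; apply: contraNneq xs => <-.
rewrite {2}qE size_Mmonic ?monic_exp ?monicXsubC // size_exp_XsubC addnS /=.
by rewrite addnC ltn_add2r IH.
Qed.

Lemma inner_zeros_in p x : x \in inner_zeros p -> -1 < x < 1.
Proof.
rewrite mem_rev => /flatten_mapP[y /polyrcf.roots_in]; rewrite in_itv /= => hy.
by rewrite mem_nseq => /andP[_ /eqP->].
Qed.

Lemma size_inner_zeros p : p != 0 -> (size (inner_zeros p) < size p)%N.
Proof.
move=> p0; rewrite size_rev size_flatten /shape -map_comp sumnE big_map.
under eq_bigr => x _ do rewrite /= size_nseq.
exact: (sum_mup_lt_size p0 (polyrcf.uniq_roots _ _ _)).
Qed.

Lemma mem_inner_zeros p x : p != 0 -> root p x -> -1 < x < 1 ->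
  x \in inner_zeros p.
Proof.
move=> p0 px x1; rewrite mem_rev; apply/flatten_mapP; exists x.
  by rewrite polyrcf.in_roots px p0 in_itv /= x1.
by rewrite mem_nseq eqxx andbT -XsubC_dvd // dvdp_XsubCl.
Qed.

Lemma count_inner_zeros p u v (s : seq R) : p != 0 -> -1 <= u -> v <= 1 ->
  zeros_in p u v s ->
  (size s <= count (fun x => u < x <= v)%R (inner_zeros p))%N.
Proof.
move=> p0 u1 v1 /andP[us /allP sall]; rewrite -size_filter; apply: uniq_leq_size => // x xs.
have /andP[/andP[ux xv] rx] := sall x xs.
rewrite mem_filter ux (ltW xv) mem_inner_zeros //.
by rewrite (le_lt_trans u1) //= (lt_le_trans xv).
Qed.

Definition shiftp p := p \Po ('X - 1).

Lemma horner_shiftp p x : (shiftp p).[1 + x] = p.[x].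
Proof. by rewrite horner_comp hornerXsubC addrAC subrr add0r. Qed.

Lemma size_shiftp p : size (shiftp p) = size p.
Proof. by rewrite size_comp_poly2 // size_XsubC. Qed.

Definition fun_of_col (c : R * {poly R}) x := (1 + x) `^ c.1 * c.2.[1 + x].

(** The half-line [x > -1], where the power is meaningful, is open, so agreement on it passes to
    derivatives; [tderivS] then gives the induction. *)
Lemma derive1n_fun_of_col (f : R -> R) c :
  (forall x, -1 < x -> f x = fun_of_col c x) ->
  forall i x, -1 < x ->
  derive1n i f x = (1 + x) `^ (c.1 - i%:R) * (tderiv c i).[1 + x].
Proof.
move=> fE; elim=> [|i IH] x x1.
  by rewrite subr0 tderiv0; exact: fE.
have t0 : 0 < 1 + x by lra.
rewrite derive1nS derive1E.
rewrite (@near_eq_derive _ _ _ (derive1n i f)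
  (fun y : R => (1 + y) `^ (c.1 - i%:R) * (tderiv c i).[1 + y])); last first.
  near=> y; apply: IH; near: y; exact: lt_nbhsr.
have d1 := is_derive_add (is_derive_const 1 x) (is_derive_var x).
have d2 := is_derive_comp d1 (is_derive1_powR (c.1 - i%:R) t0).
have d3 := is_derive_comp d1 (is_derive_poly (tderiv c i) _).
have [_ ->] := is_derive_mul d2 d3.
rewrite tderivS hornerD hornerM hornerX hornerZ.
have -> : c.1 - i.+1%:R = c.1 - i%:R - 1 by rewrite -natr1; ring.
have xe : (1 + x) `^ (c.1 - i%:R) = (1 + x) * (1 + x) `^ (c.1 - i%:R - 1).
  rewrite -[X in X * _](powRr1 (ltW t0)) -powRD; first by congr (_ `^ _); ring.
  by apply/implyP => _; rewrite gt_eqF.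
by rewrite xe; ring.
Unshelve. all: by end_near. Qed.

(** Row [i] carries the factor [t^(-i)] and column [j] the factor [t^(g_j)], with [t = 1 + x]. *)
Lemma wronskian_cols (gs : seq (R -> R)) (cs : nat -> R * {poly R}) x :
  (forall j, (j < size gs)%N -> forall y, -1 < y ->
     nth (cst 0) gs j y = fun_of_col (cs j) y) -> -1 < x ->
  wronskian gs x =
  (1 + x) `^ (\sum_(j < size gs) (cs j).1 - (\sum_(i < size gs) i)%N%:R) *
    (wronp cs (size gs)).[1 + x].
Proof.
move=> gE x1; have t0 : 0 < 1 + x by lra.
have tn : 1 + x != 0 by rewrite gt_eqF.
rewrite /wronskian horner_wronp_det.
have powD a b : (1 + x) `^ (a + b) = (1 + x) `^ a * (1 + x) `^ b.
  by rewrite powRD //; apply/implyP.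
have powS (F : 'I_(size gs) -> R) :
    \prod_i (1 + x) `^ F i = (1 + x) `^ (\sum_i F i).
  by elim/big_rec2: _ => [|i p s _ ->]; rewrite ?powRr0 ?powD.
have -> : \matrix_(i < size gs, j < size gs) derive1n i (nth (cst 0) gs j) x =
   \matrix_(i, j) ((1 + x) `^ (- i%:R) * (1 + x) `^ (cs j).1 *
      (\matrix_(i, j) ((\matrix_(i < size gs, j < size gs) tderiv (cs j) i) i j).[1 + x]) i j).
  apply/matrixP => i j; rewrite !mxE (derive1n_fun_of_col (gE j (ltn_ord j))) //.
  by rewrite powD mulrC; ring.
rewrite (det_scale_col_row _ (fun i : 'I_(size gs) => (1 + x) `^ (- (i : nat)%:R))
  (fun j : 'I_(size gs) => (1 + x) `^ (cs j).1)).
congr (_ * _); rewrite [_ - _]addrC powD natr_sum -sumrN.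
by rewrite -!powS.
Qed.
End InnerZeros.

Lemma assoc_seq_decr la i j : is_partition la -> (i < j)%N -> (j < size la)%N ->
  (assoc_seq la j < assoc_seq la i)%N.
Proof.
move=> /andP[sla _] ij jla; have ila := ltn_trans ij jla.
have geq_trans : transitive geq by move=> a b c h1 h2; exact: leq_trans h2 h1.
have := sorted_leq_nth geq_trans leqnn 0%N sla i j ila jla (ltnW ij).
rewrite /assoc_seq /geq /=; lia.
Qed.

(** * Powers of [1 + x] in the exceptional Wronskian *)

Section ExceptionalWronskian.
Variable R : realType.
Variables (la mu : seq nat) (al be : R).
Implicit Types (x : R) (s n : nat).

Let r1 := size la.
Let r2 := size mu.
Let r := (r1 + r2)%N.

Definition jacobi_col s : R * {poly R} := (0, shiftp (jacobi al be s)).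

Definition seed_cols : seq (R * {poly R}) :=
  [seq jacobi_col (assoc_seq la i) | i <- iota 0 r1] ++
  [seq (- be, shiftp (jacobi al (- be) (assoc_seq mu j))) | j <- iota 0 r2].

Definition seed_col j := nth (0, 0) seed_cols j.

Definition exc_col s := last_col seed_col r (jacobi_col s).

Lemma seed_col1 j : (j < r1)%N -> seed_col j = jacobi_col (assoc_seq la j).
Proof.
move=> jr; rewrite /seed_col nth_cat size_map size_iota jr.
by rewrite (nth_map 0%N) ?size_iota // nth_iota.
Qed.

Lemma seed_col2 j : (j < r2)%N ->
  seed_col (r1 + j) = (- be, shiftp (jacobi al (- be) (assoc_seq mu j))).
Proof.
move=> jr; rewrite /seed_col nth_cat size_map size_iota ltnNge leq_addr /= addKn.
by rewrite (nth_map 0%N) ?size_iota // nth_iota.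
Qed.

Lemma col_cases (Q : nat -> Prop) : (forall j, (j < r1)%N -> Q j) ->
  (forall j, (j < r2)%N -> Q (r1 + j)%N) -> Q r -> forall j, (j < r.+1)%N -> Q j.
Proof.
move=> Q1 Q2 Qr j; rewrite ltnS leq_eqVlt => /predU1P[->//|jr].
have [jr1|jr1] := ltnP j r1; first exact: Q1.
by rewrite -(subnKC jr1); apply: Q2; rewrite ltn_subLR.
Qed.

Lemma exc_col1 s j : (j < r1)%N -> exc_col s j = jacobi_col (assoc_seq la j).
Proof. by move=> jr; rewrite /exc_col /last_col ltn_eqF ?seed_col1 // ltn_addr. Qed.

Lemma exc_col2 s j : (j < r2)%N ->
  exc_col s (r1 + j) = (- be, shiftp (jacobi al (- be) (assoc_seq mu j))).
Proof. by move=> jr; rewrite /exc_col /last_col ltn_eqF ?seed_col2 // ltn_add2l. Qed.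

Lemma exc_colr s : exc_col s r = jacobi_col s.
Proof. by rewrite /exc_col /last_col eqxx. Qed.

Lemma sum_exc_col s : \sum_(j < r.+1) (exc_col s j).1 = - be * r2%:R.
Proof.
rewrite big_ord_recr /= exc_colr addr0 -(big_mkord predT (fun j => (exc_col s j).1)).
rewrite (big_cat_nat (leq0n r1)) ?leq_addr //= [X in X + _]big_nat_cond big1 => [|j]; last first.
  by rewrite andbT => /andP[_ jr]; rewrite exc_col1.
rewrite add0r -{1}[r1]add0n big_addn /r addKn big_mkord.
rewrite (eq_bigr (fun=> - be)) => [|j _]; last by rewrite addnC exc_col2.
by rewrite sumr_const card_ord mulr_natr.
Qed.

(** Order of vanishing from [dvdp_wronp], with [r1 + 1] columns of exponent 0 and [r2] of exponent
    [-be]. It complements the prefactor exactly: [be * r2] cancels the column exponents, and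
    [(r1 + 1) * r2] is the cross term in [C(r1 + 1 + r2, 2)]. *)
Definition exc_shift := ('C(r1.+1, 2) + 'C(r2, 2))%N.

Lemma dvdp_exc_wronp s : 'X^exc_shift %| wronp (exc_col s) r.+1.
Proof.
pose A : {set 'I_r.+1} := finset (fun j : 'I_r.+1 => ~~ (r1 <= j < r)%N).
have cA : #|~: A| = r2.
  rewrite -sum1_card (eq_bigl (fun j : 'I_r.+1 => (r1 <= j < r)%N)); last first.
    by move=> j; rewrite !inE negbK.
  rewrite -(big_mkord (fun j => (r1 <= j < r)%N) (fun=> 1%N)).
  rewrite (big_cat_nat (leq0n r1)) ?(leqW (leq_addr _ _)) //=.
  rewrite big_nat_cond big_pred0 ?add0n => [|j]; last by lia.
  rewrite (big_cat_nat (leq_addr r2 r1) (leqnSn _)) /= [X in (_ + X)%N]big_nat_cond.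
  rewrite [X in (_ + X)%N]big_pred0 ?addn0 => [|j]; last by rewrite /r; lia.
  rewrite big_nat_cond (eq_bigl (fun j => (r1 <= j < r)%N && true)) => [|j]; last by rewrite /r; lia.
  by rewrite -big_nat_cond sum_nat_const_nat muln1 addKn.
have cA' : #|A| = r1.+1.
  by have := cardsC A; rewrite cA card_ord /r; lia.
rewrite /exc_shift -{1}cA' -{1}cA; apply: (@dvdp_wronp _ _ _ A 0 (- be)) => j; rewrite inE.
move: (j : nat) (ltn_ord j); apply: col_cases => [i ir|i ir|].
- by rewrite exc_col1 // leqNgt ir.
- by rewrite exc_col2 // leq_addr ltn_add2l ir.
- by rewrite exc_colr ltnn andbF.
Qed.

Lemma size_exc_wronp : exists2 C, (0 < C)%N & forall s,
  (size (wronp (exc_col s) r.+1) <= size (jacobi al be s) + C)%N.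
Proof.
exists (\sum_(j < r) (size (seed_col j).2).-1).+1 => // s.
rewrite (leq_trans (size_wronp _ _)) // big_ord_recr /= exc_colr size_shiftp.
rewrite addnS ltnS addnC leq_add ?leq_pred // leq_eqVlt; apply/orP; left; apply/eqP.
by apply: eq_bigr => j _; rewrite /exc_col /last_col ltn_eqF.
Qed.

Lemma exc_jacobi_funE n x : -1 < x ->
  exc_jacobi_fun al be la mu n x * (1 + x) ^+ exc_shift =
  (wronp (exc_col (n + r1 - (sumn la + sumn mu))%N) r.+1).[1 + x].
Proof.
move=> x1; rewrite /exc_jacobi_fun; set s := (n + _ - _)%N.
set gs := rcons _ _.
have t0 : 0 < 1 + x by lra.
have tn : 1 + x != 0 by rewrite gt_eqF.
have sgs : size gs = r.+1 by rewrite size_rcons size_cat !size_map !size_iota.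
have gE j : (j < size gs)%N -> forall y : R, -1 < y ->
    nth (cst 0) gs j y = fun_of_col (exc_col s j) y.
  rewrite sgs; move: j; apply: col_cases => [j jr|j jr|] y y1.
  - rewrite exc_col1 // /fun_of_col powRr0 mul1r horner_shiftp nth_rcons.
    rewrite size_cat !size_map !size_iota ltn_addr // nth_cat size_map size_iota jr.
    by rewrite (nth_map 0%N) ?size_iota // nth_iota.
  - rewrite exc_col2 // /fun_of_col horner_shiftp nth_rcons.
    rewrite size_cat !size_map !size_iota ltn_add2l jr nth_cat size_map size_iota.
    rewrite ltnNge leq_addr /= addKn.
    by rewrite (nth_map 0%N) ?size_iota // nth_iota.
  - rewrite exc_colr /fun_of_col powRr0 mul1r horner_shiftp nth_rcons.
    by rewrite size_cat !size_map !size_iota ltnn eqxx.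
rewrite (wronskian_cols gE) // sgs sum_exc_col.
rewrite -powR_mulrn 1?ltW // mulrA -powRD; last by apply/implyP.
rewrite mulrAC -powRD; last by apply/implyP.
set e := (X in (1 + x) `^ X); suff -> : e = 0 by rewrite powRr0 mul1r.
have sE : (\sum_(i < r.+1) i)%N = 'C(r.+1, 2).
  by rewrite -(big_mkord predT id) /= bin2_sum.
have tri k : ('C(k.+1, 2))%:R = k%:R * (k%:R + 1) / 2 :> R.
  have : ('C(k.+1, 2) * 2 = k.+1 * k)%N.
    by rewrite mulnC -mul_bin_diag bin1.
  move/(congr1 (fun m => m%:R : R)); rewrite !natrM -[k.+1%:R]natr1 => h.
  have n2 : 2%:R != 0 :> R by rewrite pnatr_eq0.
  by apply: (mulIf n2); rewrite h; field.
have tri2 : ('C(r2, 2))%:R = r2%:R * (r2%:R - 1) / 2 :> R.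
  by case: r2 => [|k]; [rewrite bin_small // mulr0n !mul0r | rewrite tri -natr1; ring].
by rewrite /e sE /exc_shift natrD !tri tri2 /r natrD -/r1 -/r2; field.
Qed.

(** Dividing the determinant by the power of [t] gives a polynomial [V], so the set in the
    definition of [exc_jacobi] is inhabited and the chosen [p] is [V] translated. *)
Lemma exc_jacobi_rootE n (p := exc_jacobi al be la mu n)
    (W := wronp (exc_col (n + r1 - (sumn la + sumn mu))%N) r.+1) :
  [/\ forall x, -1 < x < 1 -> root p x = root W (1 + x),
      W != 0 -> p != 0 & (size p <= size W)%N].
Proof.
have /dvdpP[V VE] := dvdp_exc_wronp (n + r1 - (sumn la + sumn mu))%N.
rewrite -/W in VE.
have pE x : -1 < x -> p.[x] = exc_jacobi_fun al be la mu n x.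
  move: x; apply: (@xgetPex _ 0 [set p : {poly R} | forall x : R, -1 < x ->
    p.[x] = exc_jacobi_fun al be la mu n x]).
  exists (V \Po ('X + 1)) => x x1.
  have t0 : (1 + x) ^+ exc_shift != 0 by rewrite expf_neq0 // gt_eqF //; lra.
  apply: (mulIf t0); rewrite exc_jacobi_funE // -/W VE hornerM hornerXn.
  by rewrite horner_comp hornerD hornerX hornerC addrC.
have pV : p = V \Po ('X + 1).
  apply/eqP; rewrite -subr_eq0; apply/eqP; set D := p - _.
  (* Uniqueness is tested at the natural numbers, all larger than [-1]. *)
  apply: (@roots_geq_poly_eq0 _ D [seq i%:R | i <- iota 0 (size D)]).
  - apply/allP => _ /mapP[i _ ->]; rewrite rootE hornerD hornerN subr_eq0.
    have i1 : -1 < i%:R :> R by rewrite (lt_le_trans (ltrN10 R)).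
    have t0 : (1 + i%:R) ^+ exc_shift != 0 :> R.
      by rewrite expf_neq0 // gt_eqF //; lra.
    apply/eqP/(mulIf t0); rewrite pE // exc_jacobi_funE // -/W VE hornerM hornerXn.
    by rewrite horner_comp hornerD hornerX hornerC addrC.
  - by rewrite map_inj_uniq ?iota_uniq // => i j /eqP; rewrite eqr_nat => /eqP.
  - by rewrite size_map size_iota.
split.
- move=> x /andP[x1 _]; rewrite !rootE VE pV hornerM hornerXn.
  rewrite horner_comp hornerD hornerX hornerC addrC mulf_eq0 expf_eq0.
  by rewrite [1 + x == 0]gt_eqF ?andbF ?orbF //; lra.
- apply: contraNneq => p0; have V0 : V = 0.
    apply/eqP; rewrite -size_poly_eq0 -(@size_comp_poly2 _ V ('X + 1)).
      by rewrite -pV p0 size_poly0.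
    by rewrite size_XaddC.
  by rewrite VE V0 mul0r.
- rewrite pV size_comp_poly2 ?size_XaddC // VE.
  have [->|V0] := eqVneq V 0; first by rewrite size_poly0.
  by rewrite size_Mmonic ?monicXn // size_polyXn addnS /= leq_addr.
Qed.
End ExceptionalWronskian.

(** * Counting the zeros uniformly in the degree *)

Section ExceptionalZeros.
Variable R : realType.
Variables (la mu : seq nat) (al be : R).
Hypotheses (hla : is_partition la) (hmu : is_partition mu).
Hypothesis hal : forall i : nat, (i < size la)%N ->
  forall k : nat, (1 <= k <= assoc_seq la i)%N ->
  al + be + (assoc_seq la i)%:R <> - k%:R.
Hypothesis hbe : forall j : nat, (j < size mu)%N ->
  forall k : nat, (1 <= k <= assoc_seq mu j)%N ->
  al - be + (assoc_seq mu j)%:R <> - k%:R.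
Hypothesis hdist : forall i j : nat, (i < size la)%N -> (j < size mu)%N ->
  be <> (assoc_seq mu j)%:R - (assoc_seq la i)%:R.

Let r1 := size la.
Let r2 := size mu.
Let r := (r1 + r2)%N.
Let cols := exc_col la mu al be.
Let seeds := seed_col la mu al be.

(** From here on [al + be + s] is positive, so [P_s] has exact degree [s], and [s] is larger than
    every [n_i] and every [m_j - be]. *)
Definition large_degree : R := `|al| + `|be| + 1 +
  (\max_(i < r1) assoc_seq la i + \max_(j < r2) assoc_seq mu j)%N%:R.

Lemma size_jacobi_large s : large_degree <= s%:R -> size (jacobi al be s) = s.+1.
Proof.
move=> hs; apply: size_jacobi => k /andP[k1 _] e.
have : 0 <= (\max_(i < r1) assoc_seq la i + \max_(j < r2) assoc_seq mu j)%N%:R :> R by [].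
have : 0 <= k%:R :> R by [].
have := ler_norm (- al); have := ler_norm (- be); rewrite !normrN.
by move: hs; rewrite /large_degree; lra.
Qed.

(** The numbers to be separated for [wronp_neq0] are [n_i], [m_j - be] and [s]: strict decrease
    handles each partition, [hdist] the mixed pairs, and the size of [s] the last column. *)
Lemma cols_neq0 s k : large_degree <= s%:R -> (k <= r.+1)%N -> wronp (cols s) k != 0.
Proof.
move=> hs kr.
have big1 i : (i < r1)%N -> (assoc_seq la i <= \max_(i < r1) assoc_seq la i)%N.
  by move=> ir; exact: (@leq_bigmax _ (fun i : 'I_r1 => assoc_seq la i) (Ordinal ir)).
have big2 j : (j < r2)%N -> (assoc_seq mu j <= \max_(j < r2) assoc_seq mu j)%N.
  by move=> jr; exact: (@leq_bigmax _ (fun j : 'I_r2 => assoc_seq mu j) (Ordinal jr)).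
pose node j := (cols s j).1 + (size (cols s j).2).-1%:R.
have sz1 j : (j < r1)%N -> size (cols s j).2 = (assoc_seq la j).+1.
  by move=> jr; rewrite /cols exc_col1 // size_shiftp size_jacobi //; exact: hal.
have sz2 j : (j < r2)%N -> size (cols s (r1 + j)%N).2 = (assoc_seq mu j).+1.
  by move=> jr; rewrite /cols exc_col2 // size_shiftp size_jacobi //; exact: hbe.
have sz3 : size (cols s r).2 = s.+1.
  by rewrite /cols exc_colr size_shiftp size_jacobi_large.
have n1 j : (j < r1)%N -> node j = (assoc_seq la j)%:R.
  by move=> jr; rewrite /node sz1 // /cols exc_col1 // add0r.
have n2 j : (j < r2)%N -> node (r1 + j)%N = - be + (assoc_seq mu j)%:R.
  by move=> jr; rewrite /node sz2 // /cols exc_col2.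
have n3 : node r = s%:R by rewrite /node sz3 /cols exc_colr add0r.
have node_neq i j : (i < j)%N -> (j < r.+1)%N -> node i <> node j.
  move=> ij jr; move: ij; move: j jr.
  apply: col_cases => [j jr ij|j jr ij|ir].
  - have ir := ltn_trans ij jr; rewrite n1 // n1 // => /eqP; rewrite eqr_nat.
    by rewrite gtn_eqF // assoc_seq_decr.
  - have [ir|ir] := ltnP i r1.
      by rewrite n1 // n2 // => e; apply: (hdist ir jr); move: e; lra.
    have ij' : (i - r1 < j)%N by rewrite ltn_subLR.
    rewrite -(subnKC ir) n2 ?(ltn_trans ij') // n2 // => /addrI/eqP; rewrite eqr_nat.
    by rewrite gtn_eqF // assoc_seq_decr.
  - rewrite n3 => e.
    rewrite /large_degree natrD in hs.
    have hb := ler_norm (- be); rewrite normrN in hb.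
    have ha := normr_ge0 al; have hb' := normr_ge0 be.
    have m1 : 0 <= (\max_(i < r1) assoc_seq la i)%N%:R :> R by [].
    have m2 : 0 <= (\max_(j < r2) assoc_seq mu j)%N%:R :> R by [].
    have [ir1|ir1] := ltnP i r1.
      by move: e; rewrite n1 //; have := big1 i ir1; rewrite -(ler_nat R); lra.
    have ir2 : (i - r1 < r2)%N by rewrite ltn_subLR.
    move: e; rewrite -(subnKC ir1) n2 //; have := big2 _ ir2; rewrite -(ler_nat R); lra.
apply: wronp_neq0 => [j jk|i j ik jk nij].
  rewrite -size_poly_gt0; have jr := leq_trans jk kr; move: j jr {jk}; apply: col_cases => [j jr|j jr|].
  - by rewrite sz1.
  - by rewrite sz2.
  - by rewrite sz3.
case: (ltngtP i j) => // ij.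
  by case: (node_neq i j ij (leq_trans jk kr)).
by case: (node_neq j i ij (leq_trans ik kr)).
Qed.

Lemma seeds_neq0 k : (k <= r)%N -> wronp seeds k != 0.
Proof.
(* The first [r] columns are the same for all [s], so any large [s] serves. *)
move=> kr; have -> : wronp seeds k = wronp (cols (Num.truncn large_degree).+1) k.
  apply: eq_wronp => j jk; rewrite /cols /exc_col /last_col ltn_eqF //.
  exact: leq_trans kr.
by rewrite cols_neq0 ?leqW // ltW // truncnS_gt.
Qed.

Definition exc_index n := (n + r1 - (sumn la + sumn mu))%N.

Lemma le_exc_index n : (n <= exc_index n + (sumn la + sumn mu))%N.
Proof. by rewrite addnC -leq_subLR leq_sub2r ?leq_addr. Qed.

Lemma exc_index_ge n m : (m + (sumn la + sumn mu) <= n)%N -> (m <= exc_index n)%N.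
Proof.
by move=> mn; rewrite -(addnK (sumn la + sumn mu)%N m) leq_sub2r // (leq_trans mn) ?leq_addr.
Qed.

(** [B] collects the zeros in [(0, 2)] of the seed Wronskians, which are nonzero polynomials. It is
    fixed before [s], hence so is [L]. *)
Lemma exc_wronp_zeros : exists L : nat, forall s u v (S : seq R),
  -1 <= u -> v <= 1 -> zeros_in (jacobi al be s) u v S ->
  exists2 S', zeros_in (wronp (cols s) r.+1) (1 + u) (1 + v) S' &
    (size S <= size S' + L)%N.
Proof.
pose B := flatten [seq polyrcf.roots (wronp seeds k) 0 2 | k <- iota 0 r.+1].
exists (split_loss r (size B)) => s u v S u1 v1 /andP[uS /allP aS].
have zS : zeros_in (shiftp (jacobi al be s)) (1 + u) (1 + v) [seq 1 + x | x <- S].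
  rewrite /zeros_in map_inj_uniq ?uS /=; last exact: addrI.
  apply/allP => _ /mapP[x /aS /andP[/andP[x1 x2] rx] ->].
  by rewrite !ltrD2l x1 x2 rootE horner_shiftp.
have u0 : 0 <= 1 + u by lra.
have [|S' zS' sS'] := @zeros_wronp R seeds r (jacobi_col al be s) B _ _ _ u0 _ zS.
  move=> k x kr /andP[x1 x2] xB; apply: contraNN xB => /eqP Wx.
  apply/flatten_mapP; exists k; first by rewrite mem_iota.
  rewrite polyrcf.in_roots seeds_neq0 // andbT rootE Wx eqxx /= in_itv /=; lra.
by exists S' => //; rewrite size_map in sS'.
Qed.

Lemma exc_zeros_count a b e : 0 < a -> a < b -> b < pi -> 0 < e ->
  \forall n \near \oo, n%:R * ((b - a) / pi - e) <=
    (count (fun x => cos b < x <= cos a)%R (exc_jacobi_zeros al be la mu n))%:R.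
Proof.
move=> a0 ab bpi e0.
have pi0 : 0 < pi :> R := pi_gt0 R.
have [L hL] := exc_wronp_zeros.
have e20 : 0 < e / 2 by rewrite divr_gt0.
have [N _ hN] := jacobi_zeros_lower al be a0 ab bpi e20.
pose q := (b - a) / pi.
have q0 : 0 <= q by rewrite divr_ge0 ?subr_ge0 ?ltW.
(* The bound is trivial here; otherwise [q - e / 2] is positive and may multiply [n - K <= s]. The
   other [e / 2] absorbs the index shift [K] and the loss [L]. *)
have [qe|qe] := leP (q - e) 0.
  by apply: nearW => n; apply: (@le_trans _ _ 0) => //; rewrite mulr_ge0_le0.
pose K := (sumn la + sumn mu)%N.
near=> n.
have n1 : (N + K <= n)%N by near: n; exists (N + K)%N.
have n2 : large_degree + K%:R <= n%:R by near: n; exact: nbhs_infty_ger.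
have n3 : (K%:R * q + L%:R) / (e / 2) <= n%:R by near: n; exact: nbhs_infty_ger.
pose s := exc_index n.
have sn : n%:R <= s%:R + K%:R :> R.
  by rewrite -natrD ler_nat le_exc_index.
have sN : (N <= s)%N := exc_index_ge n1.
have sl : large_degree <= s%:R by lra.
have [S zS sS] := hN s sN.
have [S' zS' sS'] := hL s _ _ S (cos_geN1 b) (cos_le1 a) zS.
have [rp pn0 _] := exc_jacobi_rootE la mu al be n.
have p0 : exc_jacobi al be la mu n != 0 by apply: pn0; exact: cols_neq0.
have zp : zeros_in (exc_jacobi al be la mu n) (cos b) (cos a) [seq x - 1 | x <- S'].
  case/andP: zS' => uS' /allP aS'.
  rewrite /zeros_in map_inj_uniq ?uS' /=; last exact: addIr.
  apply/allP => _ /mapP[x /aS' /andP[/andP[x1 x2] rx] ->].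
  have h1 : cos b < x - 1 by lra.
  have h2 : x - 1 < cos a by lra.
  rewrite h1 h2 rp /=; first by rewrite addrCA subrr addr0.
  by rewrite (le_lt_trans (cos_geN1 b)) // (lt_le_trans h2) // cos_le1.
have := count_inner_zeros p0 (cos_geN1 b) (cos_le1 a) zp.
rewrite size_map => cS; apply: (@le_trans _ _ ((size S)%:R - L%:R)); last first.
  by rewrite lerBlDr -natrD ler_nat (leq_trans sS') // leq_add2r.
rewrite lerBrDr (le_trans _ sS) // -/q.
rewrite ler_pdivrMr // in n3.
have q1 : 0 <= q - e / 2 by lra.
have : (n%:R - K%:R) * (q - e / 2) <= s%:R * (q - e / 2) by rewrite ler_wpM2r //; lra.
have : 0 <= K%:R * (e / 2) by rewrite mulr_ge0 // ltW.
lra.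
Unshelve. all: by end_near. Qed.

(** Zeros with multiplicity are bounded by the degree, and the seed columns and the shift from [n]
    to [s] change it by bounded amounts. *)
Lemma exc_zeros_size : exists2 C : R, 0 <= C &
  \forall n \near \oo, (size (exc_jacobi_zeros al be la mu n))%:R <= n%:R + C.
Proof.
have [C C0 hC] := size_exc_wronp la mu al be.
exists (r1 + C).+1%:R => //; near=> n.
have n2 : large_degree + (sumn la + sumn mu)%N%:R <= n%:R by near: n; exact: nbhs_infty_ger.
have n3 : (sumn la + sumn mu <= n)%N by near: n; exists (sumn la + sumn mu)%N.
pose s := exc_index n.
have sn : n%:R <= s%:R + (sumn la + sumn mu)%N%:R :> R.
  by rewrite -natrD ler_nat le_exc_index.
have sl : large_degree <= s%:R by lra.
have [_ pn0 sp] := exc_jacobi_rootE la mu al be n.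
have p0 : exc_jacobi al be la mu n != 0 by apply: pn0; exact: cols_neq0.
have := size_inner_zeros p0; have := hC s; rewrite size_jacobi_large // => h1 h2.
rewrite -natrD ler_nat ltnW // (leq_trans h2) // (leq_trans sp) // (leq_trans h1) //.
by rewrite /s /exc_index; lia.
Unshelve. all: by end_near. Qed.
End ExceptionalZeros.

Unset Implicit Arguments.

Theorem theorem6p5 (R : realType) (la mu : seq nat) (al be : R)
  (hla : is_partition la) (hmu : is_partition mu)
  (hal : forall i : nat, (i < size la)%N ->
     forall k : nat, (1 <= k <= assoc_seq la i)%N ->
     al + be + (assoc_seq la i)%:R <> - k%:R)
  (hbe : forall j : nat, (j < size mu)%N ->
     forall k : nat, (1 <= k <= assoc_seq mu j)%N ->
     al - be + (assoc_seq mu j)%:R <> - k%:R)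
  (hdist : forall i j : nat, (i < size la)%N -> (j < size mu)%N ->
     be <> (assoc_seq mu j)%:R - (assoc_seq la i)%:R)
  (hal_r : -1 < al + (size la + size mu)%:R)
  (hbe_r : -1 < be + (size la + size mu)%:R)
  (f : R -> R)
  (fcont : {within (`]-1, 1[%classic : set R), continuous f})
  (fbnd : [bounded f x | x in (`]-1, 1[%classic : set R)]) :
  (fun n : nat =>
     (num_zeros al be la mu n)%:R^-1 *
     \sum_(j < num_zeros al be la mu n)
        f (nth 0 (exc_jacobi_zeros al be la mu n) j))
    @ within (degree_seq la mu) \oo -->
  (pi^-1 * \int[lebesgue_measure]_(x in `]-1, 1[) (f x / Num.sqrt (1 - x ^+ 2)) : R).
Proof.
have fc (x : R) : -1 < x < 1 -> {for x, continuous f}.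
  move=> x1; have := fcont; rewrite continuous_open_subspace; last exact: interval_open.
  by apply; rewrite inE /= in_itv.
have [M _ fM] : exists2 M : R, 0 < M & forall x : R, -1 < x < 1 -> `|f x| <= M.
  have /pinfty_ex_gt0[M M0 hM] := fbnd.
  by exists M => // x x1; apply: hM; rewrite /= in_itv.
have [C C0 hC] := exc_zeros_size hla hmu hal hbe hdist.
have := mean_arcsine_limit (fun n x => @inner_zeros_in R _ x)
  (exc_zeros_count hla hmu hal hbe hdist) C0 hC fc fM.
(* The filter within [degree_seq] is finer than [\oo], so the limit restricts to it. *)
move=> lim; apply: cvg_trans lim; apply: cvg_trans (cvg_app _ (cvg_within _)).
apply: near_eq_cvg; apply: nearW => n.
by rewrite /mean /num_zeros (big_nth 0) big_mkord.
Qed.
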